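(* (i) Let $(T_n)_{n\ge 1}$ be the sequence of $1$-NNTs (nearest-neighbour trees on the circle $\mathbb{S}_1$). Then the mean number of siblings $S(T_n)$ converges almost surely, as $n\to\infty$, to $S_1 = 1+\ln 2$. (ii) Let $(T_n)_{n\ge 1}$ be the sequence of random recursive trees (RRT). Then the mean number of siblings $S(T_n)$ converges almost surely, as $n\to\infty$, to $S_\infty = 2$.
   Context: For an integer $d\ge1$, let $\mathbb{S}_d$ be the $d$-dimensional unit sphere, equipped with the Euclidean metric $\|\cdot\|_2$ (of $\mathbb{R}^{d+1}$) and with the normalized (probability) Lebesgue measure $\lambda$. Let $(X_n)_{n\ge1}$ be i.i.d. points of $\mathbb{S}_d$ with law $\lambda$. For $n\ge2$ let $A(n)$ be the index $i\in\{1,\dots,n-1\}$ minimizing $\|X_i-X_n\|_2$ (almost surely unique; ties, which have probability zero, are broken uniformly at random). The $d$-NNT of size $n$ is the labelled tree $T_n$ with vertex set $\{1,\dots,n\}$ and edge set $\{(A(k),k): 2\le k\le n\}$; the trees $(T_n)_{n\ge 1}$ are all built from the same sequence $(X_n)$. The random recursive trees $(T_n)_{n\ge 1}$ are defined in the same way, except that the $A(n)$, $n\ge2$, are independent with $A(n)$ uniform on $\{1,\dots,n-1\}$. For $i\in\{2,\dots,n\}$, the number of siblings of $i$ in $T_n$ is $s(i)=\mathrm{card}\{j\in\{2,\dots,n\}: A(j)=A(i)\}-1$. The mean number of siblings of $T_n$ is $$S(T_n)=\frac1n\sum_{i=2}^n s(i).$$ *)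

(* Defs.v *)
From mathcomp Require Import all_boot all_order all_algebra.
From mathcomp Require Import finmap.
From mathcomp Require Import all_classical all_reals all_analysis.

Set Implicit Arguments.
Unset Strict Implicit.
Unset Printing Implicit Defensive.

Import Order.TTheory GRing.Theory Num.Theory.
Import numFieldNormedType.Exports.

Local Open Scope classical_set_scope.
Local Open Scope ring_scope.

Definition independent_family (d d' : measure_display)
    (Omega : measurableType d) (T : measurableType d') (R : realType)
    (P : probability Omega R) (D : set nat) (Y : nat -> Omega -> T) : Prop :=
  forall (s : {fset nat}) (B : nat -> set T),
    [set` s] `<=` D -> (forall i, measurable (B i)) ->
    P (\bigcap_(i in [set` s]) (Y i @^-1` B i))
    = (\prod_(i <- s) P (Y i @^-1` B i))%E.

Definition euclid_dist (R : realType) (x y : R * R) : R :=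
  Num.sqrt ((x.1 - y.1) ^+ 2 + (x.2 - y.2) ^+ 2).

Definition circle (R : realType) : set (R * R) :=
  [set x | x.1 ^+ 2 + x.2 ^+ 2 = 1].

(* Normalized arc length: the image of Lebesgue measure on [0, 1] under
   the constant-speed parametrization of the circle. *)
Definition circle_law (R : realType) : set (R * R) -> \bar R :=
  pushforward (uniform_prob (@ltr01 R))
    (fun t : R => (cos (2 * pi * t), sin (2 * pi * t))).

(* Vertices are numbered from 1, so the values [X 0], [A 0] and [A 1] of the
   sequences below are never used. *)
Definition iid_on_circle (d : measure_display) (Omega : measurableType d)
    (R : realType) (P : probability Omega R)
    (X : nat -> {RV P >-> (R * R)%type}) : Prop :=
  [/\ forall n w, (1 <= n)%N -> circle (X n w),
      forall n, (1 <= n)%N -> forall B : set (R * R), measurable B ->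
        distribution P (X n) B = circle_law B
    & independent_family P [set n | (1 <= n)%N] (fun n => X n)].

(* The indices in {1, ..., n-1} minimizing the distance to [x n]. *)
Definition nearest (R : realType) (x : nat -> R * R) (n : nat) : seq nat :=
  [seq i <- index_iota 1 n |
    all (fun j => euclid_dist (x i) (x n) <= euclid_dist (x j) (x n))
        (index_iota 1 n)].

(* Given the points, the [A k] are independent and [A k] is uniform on the set
   of minimizers: this is the joint law of (A 2, ..., A n) and (X 1, ..., X m). *)
Definition uniform_tie_breaking (d : measure_display)
    (Omega : measurableType d) (R : realType) (P : probability Omega R)
    (X : nat -> {RV P >-> (R * R)%type}) (A : nat -> {RV P >-> nat}) : Prop :=
  forall (n m : nat) (a : nat -> nat) (B : nat -> set (R * R)),
    (forall i, measurable (B i)) ->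
    let E := [set w | forall i, (1 <= i <= m)%N -> B i (X i w)] in
    P (E `&` [set w | forall k, (2 <= k <= n)%N -> A k w = a k])
    = (\int[P]_(w in E)
        (\prod_(2 <= k < n.+1)
           let M := nearest (fun i => X i w) k in
           if a k \in M then (size M)%:R^-1 else 0)%:E)%E.

Definition nearest_neighbour_attachment (d : measure_display)
    (Omega : measurableType d) (R : realType) (P : probability Omega R)
    (X : nat -> {RV P >-> (R * R)%type}) (A : nat -> {RV P >-> nat}) : Prop :=
  (forall n w, (2 <= n)%N -> A n w \in nearest (fun i => X i w) n)
  /\ uniform_tie_breaking X A.

Definition uniform_attachment (d : measure_display)
    (Omega : measurableType d) (R : realType) (P : probability Omega R)
    (A : nat -> {RV P >-> nat}) : Prop :=
  (forall n i, (2 <= n)%N ->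
     distribution P (A n) [set i]
     = (if (1 <= i < n)%N then (n.-1)%:R^-1 else 0)%:E)
  /\ independent_family P [set n | (2 <= n)%N] (fun n => A n).

(* The tree of size n is given by its parent function [a]: its vertices are
   1, ..., n and its edges are the pairs (a k, k) for 2 <= k <= n. *)
Definition siblings (R : realType) (a : nat -> nat) (n i : nat) : R :=
  (#|[set j : 'I_n.+1 | (2 <= j)%N && (a j == a i)]%SET|)%:R - 1.

Definition mean_siblings (R : realType) (a : nat -> nat) (n : nat) : R :=
  n%:R^-1 * \sum_(2 <= i < n.+1) siblings R a n i.

(* Main.v *)
Require Import Defs.
From mathcomp Require Import all_boot all_order all_algebra.
From mathcomp Require Import finmap ring lra zify.
From mathcomp Require Import all_classical all_reals all_analysis.
From mathcomp Require Import measurable_realfun.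

(** For a tree with parent function a, the quantity S(T_n) is 2 / n times the
    number of pairs of siblings, that is, of pairs of equal parents
    (mean_siblings_pairs). This number is nondecreasing in n, so it suffices to
    control it for n = k ^ 6: if its deviations from mu k have probability
    O(k ^ -2) and mu k / k ^ 6 converges, then Borel-Cantelli and interpolation
    give almost sure convergence (ae_cvg_of_summable_deviations). Both parts of
    the theorem are thus reduced to a mean and a variance, and both of these are
    computed in finite product spaces, as means over words.

    Random recursive trees. The parents are independent letters. Whatever the
    first n parents are, the next one is shared by n / n.+1 earlier vertices in
    the mean, so that the mean number of pairs is equivalent to n, and the
    centred increments are orthogonal with bounded variance (rrt_variance).

    Nearest neighbours on the circle. Cut the circle into N = 2 * M + 1 equal
    arcs, where M is a large power of n. Unless two of the distances between the
    n points nearly coincide, an event of probability O(n ^ 3 / N)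
    (mean_near_tie), the tree is a function of the arcs that contain the points,
    hence of a uniform word with letters in the cyclic group of order N
    (tree_pairs).
    - Variance. A child of v on a given side of v is at most half as far from v
      as the preceding child on that side; hence v has O(log M) children, and
      moving one point changes the number of sibling pairs by O(log M ^ 2). The
      bounded difference inequality gives a variance O(n log M ^ 4)
      (sibling_pairs_variance).
    - Mean. Let k < m be children of v, at distances s and u. If they are on
      opposite sides of v, the earlier points avoid two disjoint balls. If they
      are on the same side, then s > 2 u and the earlier points avoid the ball
      around k only. Up to a factor, after summation over v and s this is the
      integral over u of (1 - u) ^ (m - k).-1 times (1 - u) ^ k, respectively
      (1 - 2 u) ^ k (with u rescaled and 1 - 2 u replaced by 0 when negative).
      After summation over k, opposite sides contribute 1 / 2 in the limit of
      large m, and the same side contributes half of the sum of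
      (1 - 2 ^ -i) (1 / i - 1 / (i + 1)) over i >= 1, a series with sum ln 2.
      The number of pairs is therefore equivalent to n (1 + ln 2) / 2. *)

Set Implicit Arguments.
Unset Strict Implicit.
Unset Printing Implicit Defensive.

Import Order.TTheory GRing.Theory Num.Theory.
Import numFieldNormedType.Exports.

Local Open Scope classical_set_scope.
Local Open Scope ring_scope.

(** * Means over words *)

Section Mean.
Context (R : realFieldType).

Definition mean (T : Type) (r : seq T) (g : T -> R) : R :=
  (size r)%:R^-1 * \sum_(x <- r) g x.

Lemma eq_mean (T : Type) (r : seq T) (f g : T -> R) : f =1 g -> mean r f = mean r g.
Proof. by move=> fg; rewrite /mean; under eq_bigr do rewrite fg. Qed.

Lemma eq_mean_in (T : eqType) (r : seq T) (f g : T -> R) :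
  {in r, f =1 g} -> mean r f = mean r g.
Proof.
by move=> fg; rewrite /mean; congr (_ * _); rewrite big_seq [RHS]big_seq; apply: eq_bigr.
Qed.

Lemma ler_mean_in (T : eqType) (r : seq T) (f g : T -> R) :
  {in r, forall x, f x <= g x} -> mean r f <= mean r g.
Proof.
move=> fg; rewrite /mean ler_wpM2l ?invr_ge0 ?ler0n//.
by rewrite big_seq [leRHS]big_seq; apply: ler_sum.
Qed.

Lemma ler_mean (T : Type) (r : seq T) (f g : T -> R) :
  (forall x, f x <= g x) -> mean r f <= mean r g.
Proof.
by move=> fg; rewrite /mean ler_wpM2l ?invr_ge0 ?ler0n//; apply: ler_sum.
Qed.

Lemma mean_cst (T : Type) (r : seq T) (c : R) : (0 < size r)%N -> mean r (fun=> c) = c.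
Proof.
move=> r0; rewrite /mean big_const_seq count_predT iter_addr addr0.
by rewrite -(mulr_natl c) mulrA mulVf ?mul1r// pnatr_eq0 -lt0n.
Qed.

Lemma meanD (T : Type) (r : seq T) (f g : T -> R) :
  mean r (fun x => f x + g x) = mean r f + mean r g.
Proof. by rewrite /mean big_split mulrDr. Qed.

Lemma meanZ (T : Type) (r : seq T) (c : R) (f : T -> R) :
  mean r (fun x => c * f x) = c * mean r f.
Proof. by rewrite /mean -mulr_sumr mulrCA. Qed.

Lemma mean_sum (T I : Type) (r : seq T) (t : seq I) (P : pred I) (f : I -> T -> R) :
  mean r (fun x => \sum_(i <- t | P i) f i x) = \sum_(i <- t | P i) mean r (f i).
Proof. by rewrite /mean exchange_big mulr_sumr. Qed.

Lemma mean_chebyshev (T : Type) (r : seq T) (f : T -> R) (m e : R) : 0 < e ->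
  mean r (fun x => (e <= `|f x - m|)%R%:R) <= mean r (fun x => (f x - m) ^+ 2) / e ^+ 2.
Proof.
move=> e0; rewrite mulrC -meanZ; apply: ler_mean => x.
have e20 : 0 < e ^+ 2 by rewrite exprn_gt0.
case: (boolP (e <= _)%R) => h; last by rewrite mulr_ge0 ?invr_ge0 ?sqr_ge0 1?ltW.
rewrite ler_pdivlMl// mulr1 -[leRHS]real_normK ?num_real//.
by rewrite ler_sqr ?nnegrE ?normr_ge0 ?(ltW e0).
Qed.

End Mean.

Section Words.
Context (R : realFieldType) (T : eqType) (S : nat -> seq T).

(** Averaging over words S n is integration against the product of the uniform laws
    on the lists S 0, ..., S n.-1; repeated elements of a list count as weights. *)
Fixpoint words (n : nat) : seq (seq T) :=
  if n is n'.+1 then [seq rcons s a | s <- words n', a <- S n'] else [:: [::]].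

Lemma wordsP x0 n s :
  reflect (size s = n /\ forall i, (i < n)%N -> nth x0 s i \in S i) (s \in words n).
Proof.
elim: n s => [|n IH] s /=.
  apply: (iffP idP); first by rewrite inE => /eqP ->.
  by case=> /size0nil ->.
apply: (iffP allpairsP).
  case=> -[t a] /= [/IH[st ht] aS ->]; split; first by rewrite size_rcons st.
  move=> i; rewrite ltnS leq_eqVlt nth_rcons st => /orP[/eqP->|lin].
    by rewrite ltnn eqxx.
  by rewrite lin ht.
case; case/lastP: s => // t a; rewrite size_rcons => -[st] h.
exists (t, a) => /=; split => //.
  apply/IH; split=> // i lin; have := h i (ltnW lin).
  by rewrite nth_rcons st lin.
by have := h n (leqnn _); rewrite nth_rcons st ltnn eqxx.
Qed.

Lemma size_words n : size (words n) = (\prod_(i < n) size (S i))%N.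
Proof.
elim: n => [|n IH]; first by rewrite big_ord0.
by rewrite /= size_allpairs IH big_ord_recr.
Qed.

Lemma mean_words_recr n (g : seq T -> R) :
  mean (words n.+1) g = mean (words n) (fun s => mean (S n) (fun a => g (rcons s a))).
Proof.
rewrite /mean [words n.+1]/= size_allpairs natrM invfM -mulrA; congr (_ * _).
by rewrite big_allpairs_dep -mulr_sumr.
Qed.

(** The letters of a uniform word are independent. *)
Lemma mean_words_prod x0 n (phi : nat -> T -> R) :
  mean (words n) (fun s => \prod_(i < n) phi i (nth x0 s i)) =
  \prod_(i < n) mean (S i) (phi i).
Proof.
elim: n => [|n IH].
  by rewrite /mean /= invr1 mul1r big_seq1 !big_ord0.
rewrite mean_words_recr big_ord_recr /= -IH mulrC -meanZ; apply: eq_mean_in => s /(wordsP x0)[ss _].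
rewrite mulrC -meanZ; apply: eq_mean => a; rewrite big_ord_recr /=.
rewrite nth_rcons ss ltnn eqxx; congr (_ * _); apply: eq_bigr => i _.
by rewrite nth_rcons ss ltn_ord.
Qed.

(** Averaging over the last letter splits the variance into the mean of the
    conditional variance, at most c ^+ 2, and the variance of the averaged function,
    which has differences bounded by c as well. *)
Lemma bounded_differences_variance n (c : R) (g : seq T -> R) :
  (forall i, (0 < size (S i))%N) ->
  (forall s a b t, size (s ++ a :: t) = n ->
    `|g (s ++ a :: t) - g (s ++ b :: t)| <= c) ->
  mean (words n) (fun s => (g s - mean (words n) g) ^+ 2) <= n%:R * c ^+ 2.
Proof.
move=> S0; elim: n g => [|n IH] g gc.
  by rewrite /mean/= invr1 !mul1r !big_seq1 subrr expr0n mul0r.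
have [x x0] : exists x, x \in S n.
  by case: (S n) (S0 n) => // x r _; exists x; rewrite mem_head.
pose h s := mean (S n) (fun a => g (rcons s a)).
rewrite mean_words_recr (mean_words_recr n g) -/h; set m := mean (words n) h.
(* The cross term vanishes, as g - h has mean 0 given the first n letters. *)
have -> : mean (words n) (fun s => mean (S n) (fun a => (g (rcons s a) - m) ^+ 2)) =
    mean (words n) (fun s => mean (S n) (fun a => (g (rcons s a) - h s) ^+ 2)) +
    mean (words n) (fun s => (h s - m) ^+ 2).
  rewrite -meanD; apply: eq_mean => s.
  transitivity (mean (S n) (fun a => ((g (rcons s a) - h s) ^+ 2 + (h s - m) ^+ 2) +
     2 * (h s - m) * (g (rcons s a) - h s))).
    by apply: eq_mean => a; ring.
  rewrite meanD meanD mean_cst// meanZ.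
  by rewrite (meanD _ _ (fun=> - h s)) mean_cst// -/(h s) subrr mulr0 addr0.
have hc s a : size s = n -> a \in S n -> `|g (rcons s a) - h s| <= c.
  move=> ss aS.
  have -> : g (rcons s a) - h s = mean (S n) (fun b => g (rcons s a) - g (rcons s b)).
    rewrite meanD mean_cst//; congr (_ + _); rewrite /h -mulN1r -meanZ.
    by apply: eq_mean => b; rewrite mulN1r.
  have cc b : `|g (rcons s a) - g (rcons s b)| <= c.
    by rewrite -!cats1; apply: gc; rewrite size_cat /= ss addn1.
  rewrite ler_norml; apply/andP; split.
    rewrite -(mean_cst (- c) (S0 n)); apply: ler_mean => b.
    by have := cc b; rewrite ler_norml => /andP[].
  rewrite -(mean_cst c (S0 n)); apply: ler_mean => b.
  by have := cc b; rewrite ler_norml => /andP[].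
have c0 : 0 <= c.
  apply: le_trans (gc (nseq n x) x x [::] _); first exact: normr_ge0.
  by rewrite size_cat size_nseq addn1.
rewrite -natr1 mulrDl mul1r addrC; apply: lerD.
  apply: IH => s a b t st.
  have -> : h (s ++ a :: t) - h (s ++ b :: t) =
     mean (S n) (fun d => g (s ++ a :: rcons t d) - g (s ++ b :: rcons t d)).
    rewrite meanD /h; congr (_ + _).
      by apply: eq_mean => d; rewrite rcons_cat.
    rewrite -mulN1r -meanZ; apply: eq_mean => d; rewrite mulN1r rcons_cat//.
  have cc d : `|g (s ++ a :: rcons t d) - g (s ++ b :: rcons t d)| <= c.
    by apply: gc; rewrite -rcons_cons -rcons_cat size_rcons st.
  rewrite ler_norml; apply/andP; split.
    rewrite -(mean_cst (- c) (S0 n)); apply: ler_mean => d.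
    by have := cc d; rewrite ler_norml => /andP[].
  rewrite -(mean_cst c (S0 n)); apply: ler_mean => d.
  by have := cc d; rewrite ler_norml => /andP[].
have W0 : (0 < size (words n))%N by rewrite size_words prodn_gt0.
rewrite -[leRHS](mean_cst _ W0); apply: ler_mean_in => s /(wordsP x)[ss _].
rewrite -[leRHS](mean_cst _ (S0 n)); apply: ler_mean_in => a aS.
rewrite -[leLHS]real_normK ?num_real// ler_sqr ?nnegrE ?normr_ge0//.
exact: hc.
Qed.

End Words.

(** * Sibling pairs and random recursive trees *)

Section Pairs.
Variable T : eqType.
Implicit Type s : seq T.

Fixpoint pairs s : nat :=
  if s is x :: t then (count_mem x t + pairs t)%N else 0%N.

Lemma pairs_rcons s a : pairs (rcons s a) = (pairs s + count_mem a s)%N.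
Proof.
elim: s => //= x s ->; rewrite -cats1 count_cat /= eq_sym.
by rewrite addnACA addn0 -!addnA; congr addn; rewrite addnCA addnC.
Qed.

Lemma pairs_nth x0 s :
  pairs s = (\sum_(j < size s) \sum_(i < j) (nth x0 s i == nth x0 s j))%N.
Proof.
elim/last_ind: s => [|s a IH]; first by rewrite big_ord0.
rewrite pairs_rcons size_rcons big_ord_recr /= IH; congr addn.
  apply: eq_bigr => j _; apply: eq_bigr => i _.
  by rewrite !nth_rcons ltn_ord (ltn_trans (ltn_ord i) (ltn_ord j)).
rewrite -sum1_count (big_nth x0) big_mkcond/= big_mkord; apply: eq_bigr => i _.
by rewrite !nth_rcons ltn_ord ltnn eqxx; case: eqP.
Qed.

(** Ordered pairs of positions with equal letters: the diagonal, and each unordered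
    pair twice. *)
Lemma sum_count_mem s : (\sum_(x <- s) count_mem x s = size s + (pairs s).*2)%N.
Proof.
elim: s => [|x s IH]; first by rewrite big_nil.
rewrite big_cons /= eqxx; under eq_bigr do rewrite eq_sym.
rewrite big_split /= IH.
have -> : (\sum_(i <- s) (i == x) = count_mem x s)%N.
  by rewrite -sum1_count [RHS]big_mkcond; apply: eq_bigr => i _ /=; case: (i == x).
rewrite doubleD; lia.
Qed.

Lemma pairs_cat s t : (pairs s <= pairs (s ++ t))%N.
Proof.
elim: s => //= x s IH; rewrite count_cat; lia.
Qed.

Lemma sum_mul_count_mem (A : pzSemiRingType) (F : T -> A) (r s : seq T) :
  uniq r -> {subset s <= r} ->
  \sum_(a <- r) F a * (count_mem a s)%:R = \sum_(x <- s) F x.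
Proof.
move=> ur; elim: s => [|x s IH] sr /=.
  by rewrite big_nil big1// => a _; rewrite mulr0.
under eq_bigr do rewrite natrD mulrDr; rewrite big_split /= big_cons.
rewrite IH; last by move=> y ys; apply: sr; rewrite inE ys orbT.
congr (_ + _); rewrite (bigD1_seq x) ?sr ?mem_head//= eqxx mulr1.
by rewrite big1 ?addr0// => a /negPf ax; rewrite eq_sym ax mulr0.
Qed.

End Pairs.

Section RandomRecursiveTree.
Variable R : realFieldType.
Let S (i : nat) := iota 1 i.+1.

(** The mean over a of the squared count is the mean number of earlier siblings of an
    earlier vertex, which sum_count_mem expresses through pairs. *)
Lemma mean_count_parents n s : s \in words S n ->
  mean (S n) (fun a => (count_mem a s)%:R : R) = n%:R / n.+1%:R /\
  mean (S n) (fun a => (count_mem a s)%:R ^+ 2 : R) =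
    (n%:R + 2 * (pairs s)%:R) / n.+1%:R.
Proof.
move=> /(wordsP S 0%N)[ss sS].
have sub : {subset s <= S n}.
  move=> x xs; have ix : (index x s < n)%N by rewrite -ss index_mem.
  have := sS _ ix; rewrite nth_index// !mem_iota; lia.
rewrite /mean size_iota; split; rewrite [LHS]mulrC; congr (_ / _).
  transitivity (\sum_(a <- S n) 1 * (count_mem a s)%:R : R).
    by apply: eq_bigr => a _; rewrite mul1r.
  by rewrite (sum_mul_count_mem (fun=> 1)) ?iota_uniq// big_const_seq count_predT ss iter_addr
    addr0.
under eq_bigr do rewrite expr2.
rewrite (sum_mul_count_mem (fun a => (count_mem a s)%:R)) ?iota_uniq//.
by rewrite -natr_sum sum_count_mem ss natrD -muln2 natrM mulrC.
Qed.

Definition rrt_mean n : R := \sum_(0 <= i < n) i%:R / i.+1%:R.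

Lemma rrt_mean_pairs n : mean (words S n) (fun s => (pairs s)%:R) = rrt_mean n.
Proof.
elim: n => [|n IH].
  by rewrite /mean /= big_seq1 /rrt_mean big_geq// mulr0.
rewrite mean_words_recr /rrt_mean big_nat_recr//= -/(rrt_mean n) -IH.
have W0 : (0 < size (words S n))%N.
  by rewrite size_words prodn_gt0// => i; rewrite size_iota.
rewrite -[X in _ = _ + X](mean_cst _ W0) -meanD; apply: eq_mean_in => s sW.
have [<- _] := mean_count_parents sW.
rewrite -[X in _ = X + _](mean_cst (r := S n)) ?size_iota// -meanD; apply: eq_mean => a.
by rewrite pairs_rcons natrD.
Qed.

Lemma rrt_mean_le n : 0 <= rrt_mean n <= n%:R.
Proof.
rewrite /rrt_mean; apply/andP; split; first by apply: sumr_ge0 => i _; rewrite divr_ge0.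
apply: (@le_trans _ _ (\sum_(0 <= i < n) 1)).
  by apply: ler_sum => i _; rewrite ler_pdivrMr ?mul1r ?ler_nat ?ltr0n//.
by rewrite big_const_nat subn0 iter_addr addr0.
Qed.

(** The increments, once centred, are orthogonal. The second moment of each of them is
    at most (n + 2 * n) / n.+1, because the mean of pairs is at most n. *)
Lemma rrt_variance n :
  mean (words S n) (fun s => ((pairs s)%:R - rrt_mean n) ^+ 2) <= 3 * n%:R.
Proof.
elim: n => [|n IH].
  by rewrite /mean /= big_seq1 /rrt_mean big_geq// subrr expr0n/= !mulr0.
have W0 : (0 < size (words S n))%N.
  by rewrite size_words prodn_gt0// => i; rewrite size_iota.
have S0 : (0 < size (S n))%N by rewrite size_iota.
rewrite mean_words_recr -(natr1 n) mulrDr mulr1.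
pose c : R := n%:R / n.+1%:R.
have := rrt_mean_le n => /andP[_ rn].
have -> : rrt_mean n.+1 = rrt_mean n + c by rewrite /rrt_mean big_nat_recr.
apply: (@le_trans _ _ (mean (words S n) (fun s => ((pairs s)%:R - rrt_mean n) ^+ 2) +
   mean (words S n) (fun s => (n%:R + 2 * (pairs s)%:R) / n.+1%:R))); last first.
  apply: lerD => //.
  have -> : mean (words S n) (fun s => (n%:R + 2 * (pairs s)%:R) / n.+1%:R : R) =
    n.+1%:R^-1 * (n%:R + 2 * rrt_mean n).
    rewrite -rrt_mean_pairs -meanZ -[X in _ * (X + _)](mean_cst _ W0) -meanD -meanZ.
    by apply: eq_mean => s; rewrite mulrC.
  rewrite mulrC ler_pdivrMr ?ltr0n// -(natr1 n); have : 0 <= n%:R :> R by [].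
  lra.
rewrite -meanD; apply: ler_mean_in => s sW.
have [m1 m2] := mean_count_parents sW.
rewrite -m2 -(mean_cst (((pairs s)%:R - rrt_mean n) ^+ 2) S0) -meanD.
have -> : mean (S n) (fun a => ((pairs (rcons s a))%:R - (rrt_mean n + c)) ^+ 2) =
  mean (S n) (fun a => (((pairs s)%:R - rrt_mean n) ^+ 2 + (count_mem a s)%:R ^+ 2 + c ^+ 2
    - (2 * c * ((pairs s)%:R - rrt_mean n)))
    + (2 * ((pairs s)%:R - rrt_mean n) - 2 * c) * (count_mem a s)%:R : R).
  by apply: eq_mean => a; rewrite pairs_rcons natrD; ring.
rewrite !meanD !mean_cst// meanZ m1 -/c.
have := sqr_ge0 c; lra.
Qed.

End RandomRecursiveTree.

(** * Nearest-neighbour trees in a cyclic group *)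

Section CyclicNorm.
Variable M : nat.
Let T := 'I_(M.*2).+1.

(** The circle is modelled by the cyclic group 'I_N with N = 2 * M + 1, and cnorm is the
    distance to 0. As N is odd there are no antipodal points: each nonzero element is
    on exactly one side of 0. *)
Definition cnorm (d : 'I_(M.*2).+1) : nat := minn d ((M.*2).+1 - d).

Lemma val_oppI (d : T) : val (- d) = (if val d == 0 then 0 else (M.*2).+1 - d)%N.
Proof.
rewrite /=; case: eqP => [->|d0]; first by rewrite subn0 modnn.
by rewrite modn_small// ltn_subLR ?(ltnW (ltn_ord d))//; have := ltn_ord d; lia.
Qed.

Lemma val_subI (x y : T) :
  val (x - y) = (if y <= x then x - y else (M.*2).+1 + x - y)%N.
Proof.
have hx := ltn_ord x; have hy := ltn_ord y.
rewrite /= modnDmr; case: ifP => yx.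
  have -> : (x + ((M.*2).+1 - y) = (x - y) + (M.*2).+1)%N by lia.
  by rewrite modnDr modn_small//; lia.
rewrite modn_small//; lia.
Qed.

Lemma cnormN d : cnorm (- d) = cnorm d.
Proof.
rewrite /cnorm val_oppI; have := ltn_ord d; case: eqP => [->|]; lia.
Qed.

Lemma cnormB x y : cnorm (x - y) = cnorm (y - x).
Proof. by rewrite -cnormN opprB. Qed.

Lemma cnorm_gt0 d : (0 < cnorm d)%N = (d != 0).
Proof. rewrite /cnorm -val_eqE /=; have := ltn_ord d; lia. Qed.

Lemma cnorm0 : cnorm 0 = 0%N.
Proof. by rewrite /cnorm /= min0n. Qed.

End CyclicNorm.

(** The last element is at least 1, so the first one is at least 2 ^ (size s).-1. *)
Lemma halving_size (s : seq nat) M : pairwise (fun x y => (2 * y <= x)%N) s ->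
  all (fun x => 0 < x <= M)%N s -> (size s <= (trunc_log 2 M).+1)%N.
Proof.
case: s => // x t pw /= /andP[/andP[x0 xM] tM]; rewrite ltnS.
have M0 : (0 < M)%N by lia.
suff : (2 ^ size t <= x)%N by move=> h; apply: trunc_log_max => //; exact: leq_trans h xM.
elim: t x x0 {xM} pw tM => [|y t IH] x x0 //= /andP[/andP[xy _] pw] /andP[/andP[y0 _] tM].
by rewrite expnS (leq_trans _ xy)// leq_mul2l IH.
Qed.

Arguments cnorm {M} d%_ring_scope.

(** At most (trunc_log 2 M).+1 children on each side, see degree_le. *)
Definition max_degree (M : nat) := (2 * (trunc_log 2 M).+1)%N.

Section DegreeBound.
Variable M : nat.
Let T := 'I_(M.*2).+1.

(** On a given side of a, let d and d' be the distances to a of an earlier and a later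
    point of Z. The later point is at distance |d - d'| from the earlier one, so that
    d' <= |d - d'|, which forces 2 * d' <= d; halving_size then applies to each side. *)
Lemma halving_count (x : nat -> T) (a : T) (Z : pred nat) n :
  (forall k, Z k -> x k != a) ->
  (forall k k', (k < k')%N -> Z k -> Z k' ->
     (cnorm (a - x k') <= cnorm (x k - x k'))%N) ->
  (count Z (iota 0 n) <= max_degree M)%N.
Proof.
move=> Za Zd.
pose right k := Z k && ((x k - a)%R <= M)%N.
pose left k := Z k && (M < (x k - a)%R)%N.
have -> : count Z (iota 0 n) = (count right (iota 0 n) + count left (iota 0 n))%N.
  rewrite -count_predUI [X in (_ + X)%N](_ : _ = 0)%N.
    by rewrite addn0; apply: eq_count => k /=; rewrite /right /left; case: leqP; case: (Z k).
  by apply/eqP; rewrite -leqn0 leqNgt -has_count -all_predC; apply/allP => k _ /=;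
    rewrite /right /left; case: leqP; case: (Z k).
have pw (P : pred nat) (g : nat -> nat) :
    (forall k k', (k < k')%N -> P k -> P k' -> (2 * g k' <= g k)%N) ->
    (forall k, P k -> (0 < g k <= M)%N) -> (count P (iota 0 n) <= (trunc_log 2 M).+1)%N.
  move=> hP gM; rewrite -size_filter -(size_map g); apply: halving_size.
    rewrite pairwise_map.
    have : pairwise ltn [seq k <- iota 0 n | P k].
      by apply: pairwise_filter; rewrite -sorted_pairwise ?iota_ltn_sorted//; exact: ltn_trans.
    move=> /(pairwiseP 0%N) h; apply/(pairwiseP 0%N) => i j isz jsz ij.
    have inP l : (l < size [seq k <- iota 0 n | P k])%N -> P (nth 0%N [seq k <- iota 0 n | P k] l).
      by move=> lsz; have := mem_nth 0%N lsz; rewrite mem_filter => /andP[].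
    by apply: hP; [exact: h|exact: inP|exact: inP].
  by apply/allP => y /mapP[k]; rewrite mem_filter => /andP[Pk _] ->; exact: gM.
have dpos k : Z k -> (0 < (x k - a)%R)%N.
  by move=> /Za; rewrite -subr_eq0 -val_eqE /= -lt0n.
have sub k k' : x k - x k' = (x k - a) - (x k' - a) by rewrite opprB addrA subrK.
rewrite /max_degree mul2n -addnn; apply: leq_add.
  apply: (pw _ (fun k => nat_of_ord (x k - a))) => [k k' kk'|k] /andP[Zk dk].
    move=> /andP[Zk' dk']; have := Zd _ _ kk' Zk Zk'; rewrite cnormB sub.
    have := dpos _ Zk; have := dpos _ Zk'.
    set d := x k - a in dk *; set d' := x k' - a in dk' *.
    clearbody d d'; rewrite /cnorm (val_subI d d'); case: ifP; lia.
  by rewrite dpos.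
apply: (pw _ (fun k => (M.*2).+1 - (x k - a)%R)%N) => [k k' kk'|k] /andP[Zk dk].
  move=> /andP[Zk' dk']; have := Zd _ _ kk' Zk Zk'; rewrite cnormB sub.
  have := dpos _ Zk; have := dpos _ Zk'.
  have := ltn_ord (x k - a); have := ltn_ord (x k' - a).
  set d := x k - a in dk *; set d' := x k' - a in dk' *.
  clearbody d d'; rewrite /cnorm (val_subI d d'); case: ifP; lia.
have := ltn_ord (x k - a); set d := x k - a in dk *; lia.
Qed.

End DegreeBound.

Lemma sum_pred_le1 (p : pred nat) n : (forall u v, p u -> p v -> u = v) ->
  (\sum_(0 <= v < n) p v <= 1)%N.
Proof.
move=> inj; elim: n => [|n IH]; first by rewrite big_geq.
rewrite big_nat_recr//=; case pn: (p n); last by rewrite addn0.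
rewrite big_nat big1// => i /andP[_ lin]; case pi: (p i) => //.
by rewrite (inj _ _ pi pn) ltnn in lin.
Qed.

Lemma sum_pred_count (p : pred nat) n :
  (\sum_(0 <= v < n) p v = count p (iota 0 n))%N.
Proof.
by rewrite -sum1_count [RHS]big_mkcond /index_iota subn0; apply: eq_bigr => i _; case: (p i).
Qed.

Section StrictChildren.
Variable M : nat.
Let T := 'I_(M.*2).+1.
Implicit Types (al : pred nat) (x : nat -> T).

(** The vertex v is the parent of k in the tree grown from the points with labels in al.
    In case of a tie, or of a point equal to an earlier one, k is left without parent:
    then degree_le holds without any condition on the points, and words with near ties
    are discarded separately. Taking al to be predC1 i removes the point i. *)
Definition child al x (v k : nat) : bool :=
  [&& al v, al k, (v < k)%N, x v != x k &
    all (fun j => al j ==> (j != v) ==> (cnorm (x v - x k) < cnorm (x j - x k))%N)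
      (iota 0 k)].

Lemma childP al x v k :
  reflect [/\ al v, al k, (v < k)%N, x v != x k &
    forall j, (j < k)%N -> al j -> j != v -> (cnorm (x v - x k) < cnorm (x j - x k))%N]
    (child al x v k).
Proof.
apply: (iffP and5P) => -[av ak vk xvk h]; split=> //.
  move=> j jk aj jv; move/allP: h => /(_ j); rewrite mem_iota add0n jk => /(_ isT).
  by rewrite aj jv.
by apply/allP => j; rewrite mem_iota add0n => /= jk; apply/implyP => aj; apply/implyP => jv;
  apply: h.
Qed.

Lemma child_parent_uniq al x u v k : child al x u k -> child al x v k -> u = v.
Proof.
move=> /childP[au _ uk _ hu] /childP[av _ vk _ hv]; apply/eqP; case: eqVneq => // uv.
have := hu _ vk av; rewrite eq_sym uv => /(_ isT).
by have := hv _ uk au uv; lia.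
Qed.

Lemma sum_child_parent al x n k : (\sum_(0 <= v < n) child al x v k <= 1)%N.
Proof. by apply: sum_pred_le1 => u v; exact: child_parent_uniq. Qed.

(** A later child of v is closer to v than to any earlier child of v. *)
Lemma degree_le al x n v : (\sum_(0 <= k < n) child al x v k <= max_degree M)%N.
Proof.
rewrite sum_pred_count; apply: (@halving_count _ x (x v)) => [k /childP[_ _ _]|].
  by rewrite eq_sym.
move=> k k' kk' /childP[_ ak vk _ _] /childP[_ _ _ _ h].
by apply/ltnW/h => //; rewrite gtn_eqF.
Qed.

Definition sibling_pairs al x n : nat :=
  (\sum_(0 <= v < n) \sum_(0 <= k < n) \sum_(0 <= m < n)
     [&& k < m, child al x v k & child al x v m])%N.

Lemma eq_child al x y v k : (forall j, al j -> x j = y j) ->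
  child al x v k = child al y v k.
Proof.
move=> xy; apply/childP/childP => -[av ak vk nvk h]; split => //.
- by rewrite -!xy.
- by move=> j jk aj jv; rewrite -!xy//; apply: h.
- by rewrite !xy.
- by move=> j jk aj jv; rewrite !xy//; apply: h.
Qed.

Section Removal.
Variables (x : nat -> T) (i n : nat).
Local Notation K := (child predT x).
Local Notation K' := (child (predC1 i) x).
Let new v k := K' v k && ~~ K v k.

Lemma child_remove v k : v != i -> k != i -> K v k -> K' v k.
Proof.
move=> vi ki /childP[_ _ vk nvk h]; apply/childP; split => // j jk _; exact: h.
Qed.

(** The removal of i provides k with a new parent only if i was in the way, that is, at
    least as close to k as this new parent. *)
Lemma new_child_removed v k : new v k ->
  [/\ K' v k, (i < k)%N & (cnorm (x i - x k) <= cnorm (x v - x k))%N].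
Proof.
move=> /andP[K'vk nK]; move/childP: (K'vk) => [vi ki vk nvk h].
have : ~~ all (fun j => (j != v) ==> (cnorm (x v - x k) < cnorm (x j - x k))%N) (iota 0 k).
  by apply: contra nK => hall; apply/and5P; split.
move=> /allPn[j]; rewrite mem_iota add0n => /= jk.
rewrite negb_imply -leqNgt => /andP[jv hj].
have ji : j = i by apply/eqP; case: eqVneq => // ji; have := h _ jk ji jv; lia.
by split; [exact: K'vk| rewrite -ji| rewrite -ji].
Qed.

(** The vertices with a new parent satisfy the halving condition around x i, except for
    those placed exactly at x i. Of the latter there is at most one, since a second one
    would be at distance 0 from the first and could not get a parent. *)
Lemma sum_new_le : (\sum_(0 <= v < n) \sum_(0 <= k < n) new v k <= (max_degree M).+1)%N.
Proof.
pose Z k := has (fun v => new v k) (iota 0 n).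
apply: (@leq_trans (\sum_(0 <= k < n) Z k)).
  rewrite exchange_big /=; apply: leq_sum => k _.
  case Zk: (Z k).
    apply: sum_pred_le1 => u v /andP[h _] /andP[h' _]; exact: child_parent_uniq h h'.
  rewrite big_seq big1// => v; rewrite /index_iota subn0 => vn.
  by move/hasPn: Zk => /(_ v vn)/negPf->.
(* Z2 collects the points equal to x i, to which halving_count does not apply. *)
pose Z1 k := Z k && (x k != x i); pose Z2 k := Z k && (x k == x i).
have -> : (\sum_(0 <= k < n) Z k = \sum_(0 <= k < n) Z1 k + \sum_(0 <= k < n) Z2 k)%N.
  rewrite -big_split; apply: eq_bigr => k _; rewrite /Z1 /Z2.
  by case: (Z k); case: (x k == x i).
rewrite -addn1; apply: leq_add.
  rewrite sum_pred_count; apply: (@halving_count _ x (x i)) => [k /andP[]//|].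
  move=> k k' kk' /andP[/hasP[v _ /new_child_removed[/childP[_ ki _ _ _] _ _]] _].
  move=> /andP[/hasP[v' _ /new_child_removed[/childP[_ _ _ _ h] _ hi]] _].
  apply: (leq_trans hi); case: (eqVneq k v') => [->//|kv'].
  exact/ltnW/h.
have uq k k' : Z2 k -> Z2 k' -> (k < k')%N -> False.
  move=> /andP[/hasP[v _ /new_child_removed[/childP[_ ki _ _ _] _ _]] /eqP xk].
  move=> /andP[/hasP[v' _ /new_child_removed[/childP[_ _ _ nv' h] _ hi]] /eqP xk'] kk'.
  have := cnorm_gt0 (x v' - x k'); rewrite subr_eq0 nv' => pos.
  case: (eqVneq k v') => [kv'|kv'].
    by move: nv'; rewrite -kv' xk xk' eqxx.
  by have := h _ kk' ki kv'; rewrite xk xk' subrr cnorm0.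
apply: sum_pred_le1 => u v Zu Zv; case: (ltngtP u v) => // uv.
  by have := uq _ _ Zu Zv uv.
by have := uq _ _ Zv Zu uv.
Qed.

(** A lost pair involves i, either as the parent, which gives at most D ^ 2 pairs, or as
    one of the two siblings, which gives at most D pairs in each of the two roles. *)
Lemma sibling_pairs_remove_le :
  (sibling_pairs predT x n <= sibling_pairs (predC1 i) x n +
    ((max_degree M) ^ 2 + 2 * max_degree M))%N.
Proof.
set D := max_degree M.
have hD v : (\sum_(0 <= k < n) K v k <= D)%N by exact: degree_le.
pose a1 := (\sum_(0 <= v < n) \sum_(0 <= k < n) \sum_(0 <= m < n) ((v == i) * (K v k * K v m)))%N.
pose a2 := (\sum_(0 <= v < n) \sum_(0 <= k < n) \sum_(0 <= m < n) ((k == i) * (K v k * K v m)))%N.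
pose a3 := (\sum_(0 <= v < n) \sum_(0 <= k < n) \sum_(0 <= m < n) ((m == i) * (K v k * K v m)))%N.
have sel (F : nat -> nat) : (\sum_(0 <= k < n) (k == i) * F k <= F i)%N.
  have [lin|nin] := boolP (i \in index_iota 0 n).
    rewrite (bigD1_seq i) ?iota_uniq//= eqxx mul1n big1 ?addn0// => k /negPf->//.
  rewrite big_seq big1// => k kn; case: eqP => // ki; by rewrite ki (negPf nin) in kn.
have h1 : (a1 <= D ^ 2)%N.
  rewrite /a1; under eq_bigr do under eq_bigr do rewrite -big_distrr /=.
  under eq_bigr do rewrite -big_distrr /=.
  apply: leq_trans (sel _) _.
  under eq_bigr do rewrite -big_distrr /=.
  by rewrite -big_distrl /= leq_mul.
have h2 : (a2 <= D)%N.
  rewrite /a2; apply: (@leq_trans (\sum_(0 <= v < n) K v i * D)).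
    apply: leq_sum => v _; under eq_bigr do rewrite -big_distrr -big_distrr /=.
    by apply: leq_trans (sel _) _; rewrite leq_mul2l hD orbT.
  rewrite -big_distrl /= -[leqRHS]mul1n leq_mul2r; apply/orP; right; exact: sum_child_parent.
have h3 : (a3 <= D)%N.
  rewrite /a3; apply: (@leq_trans (\sum_(0 <= v < n) K v i * D)).
    apply: leq_sum => v _; rewrite exchange_big /=.
    under eq_bigr do rewrite -big_distrr -big_distrl /=.
    by apply: leq_trans (sel _) _; rewrite mulnC leq_mul2l hD orbT.
  rewrite -big_distrl /= -[leqRHS]mul1n leq_mul2r; apply/orP; right; exact: sum_child_parent.
apply: (@leq_trans (sibling_pairs (predC1 i) x n + (a1 + (a2 + a3)))); last by lia.
rewrite /a1 /a2 /a3 /sibling_pairs.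
rewrite -!big_split; apply: leq_sum => v _ /=.
rewrite -!big_split; apply: leq_sum => k _ /=.
rewrite -!big_split; apply: leq_sum => m _ /=.
have impl l : [&& v != i, l != i & K v l] ==> K' v l.
  by apply/implyP => /and3P[vi li]; exact: child_remove.
move: (impl k) (impl m).
by case: (v == i); case: (k == i); case: (m == i); case: (K v k); case: (K v m);
  case: (K' v k); case: (K' v m); case: (k < m)%N.
Qed.

(** In a gained pair one of the two siblings has a new parent. *)
Lemma sibling_pairs_remove_ge :
  (sibling_pairs (predC1 i) x n <= sibling_pairs predT x n +
    2 * ((max_degree M).+1 * max_degree M))%N.
Proof.
set D := max_degree M.
have hD v : (\sum_(0 <= k < n) K' v k <= D)%N by exact: degree_le.
pose a := (\sum_(0 <= v < n) \sum_(0 <= k < n) \sum_(0 <= m < n) (new v k * K' v m))%N.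
pose b := (\sum_(0 <= v < n) \sum_(0 <= k < n) \sum_(0 <= m < n) (K' v k * new v m))%N.
have ha : (a <= D.+1 * D)%N.
  rewrite /a; under eq_bigr do under eq_bigr do rewrite -big_distrr /=.
  apply: (@leq_trans (\sum_(0 <= v < n) \sum_(0 <= k < n) new v k * D)).
    by apply: leq_sum => v _; apply: leq_sum => k _; rewrite leq_mul2l hD orbT.
  under eq_bigr do rewrite -big_distrl /=.
  by rewrite -big_distrl /= leq_mul2r sum_new_le orbT.
have hb : (b <= D.+1 * D)%N.
  apply: leq_trans ha; rewrite /a /b; apply: leq_sum => v _.
  rewrite exchange_big /=; apply: leq_sum => k _; apply: leq_sum => m _; by rewrite mulnC.
apply: (@leq_trans (sibling_pairs predT x n + (a + b))); last by lia.
rewrite /a /b /sibling_pairs /new.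
rewrite -!big_split; apply: leq_sum => v _ /=.
rewrite -!big_split; apply: leq_sum => k _ /=.
rewrite -!big_split; apply: leq_sum => m _ /=.
by case: (K v k); case: (K v m); case: (K' v k); case: (K' v m); case: (k < m)%N.
Qed.

End Removal.

(** Both trees are compared with the one obtained by removing the point i. *)
Lemma sibling_pairs_change (R : realFieldType) x y i n : (forall j, j != i -> x j = y j) ->
  `|(sibling_pairs predT x n)%:R - (sibling_pairs predT y n)%:R : R| <=
    (4 * (max_degree M).+1 ^ 2)%:R.
Proof.
move=> xy; set D := max_degree M.
have e : sibling_pairs (predC1 i) x n = sibling_pairs (predC1 i) y n.
  rewrite /sibling_pairs; do 3 (apply: eq_bigr => ? _).
  by congr (nat_of_bool [&& _, _ & _]); apply: eq_child => j; exact: xy.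
have := sibling_pairs_remove_le x i n; have := sibling_pairs_remove_ge x i n.
have := sibling_pairs_remove_le y i n; have := sibling_pairs_remove_ge y i n.
rewrite -e -/D; set a := sibling_pairs predT x n; set b := sibling_pairs predT y n.
set c := sibling_pairs _ x n => h1 h2 h3 h4.
have : (a <= b + 4 * D.+1 ^ 2)%N by rewrite expnS expn1; lia.
have : (b <= a + 4 * D.+1 ^ 2)%N by rewrite expnS expn1; lia.
rewrite -!(ler_nat R) !natrD ler_norml; lra.
Qed.

End StrictChildren.

Lemma sibling_pairs_variance (R : realFieldType) M n :
  let W := words (fun=> enum 'I_(M.*2).+1) n in
  let g := fun s : seq 'I_(M.*2).+1 => (sibling_pairs predT (nth 0 s) n)%:R : R in
  mean W (fun s => (g s - mean W g) ^+ 2) <= n%:R * (4 * (max_degree M).+1 ^ 2)%:R ^+ 2.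
Proof.
apply: bounded_differences_variance => [i|s a b t _]; first by rewrite size_enum_ord.
apply: (@sibling_pairs_change _ _ _ _ (size s)) => j js.
rewrite !nth_cat; case: ltnP => // sj; case e: (j - size s)%N => //.
by case/eqP: js; apply: anti_leq; rewrite sj andbT -subn_eq0 e.
Qed.

(** * Mean number of sibling pairs in a cyclic group: exact formula *)

Lemma prod_natr_bool (R : comNzRingType) n (b : nat -> bool) :
  \prod_(i < n) (b i)%:R = (all b (iota 0 n))%:R :> R.
Proof.
elim: n => [|n IH]; first by rewrite big_ord0.
rewrite big_ord_recr IH -[in RHS]addn1 iotaD all_cat /= add0n andbT -natrM.
by case: all; case: (b n).
Qed.

(** Three letters are prescribed, those before k obey one constraint, those between k
    and m another one, and those after m are free. *)
Lemma prod_three_marked (R : comNzRingType) (p q r : R) v k m n :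
  (v < k)%N -> (k < m)%N -> (m < n)%N ->
  \prod_(j < n) (if j == v :> nat then p else if j == k :> nat then p
     else if j == m :> nat then p else if (j < k)%N then q else if (j < m)%N then r else 1)
  = p ^+ 3 * q ^+ k.-1 * r ^+ (m - k).-1.
Proof.
move=> vk km mn.
set h := fun j : nat => if j == v then p else if j == k then p else if j == m then p
     else if (j < k)%N then q else if (j < m)%N then r else 1.
rewrite -(big_mkord xpredT h).
have hc c a b : (forall j, (a <= j < b)%N -> h j = c) -> \prod_(a <= j < b) h j = c ^+ (b - a).
  move=> hj; rewrite big_nat (eq_bigr (fun=> c))// -big_nat prodr_const_nat//.
have hE := fun j => erefl (h j).
have c1 : (v.+1 <= k.+1)%N by lia.
have c2 : (k.+1 <= m.+1)%N by lia.
rewrite (big_cat_nat (leq0n m.+1) mn)/= big_nat_recr//=.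
rewrite (big_cat_nat (leq0n k.+1) km)/= big_nat_recr//=.
rewrite (big_cat_nat (leq0n v.+1) vk)/= big_nat_recr//=.
have tac j (b : R) : (j != v) -> (j != k) -> (j != m) ->
    (if (j < k)%N then q else if (j < m)%N then r else 1) = b -> h j = b.
  by rewrite /h => /negPf-> /negPf-> /negPf->.
rewrite (hc q 0%N v); last first.
  by move=> j jr; apply: tac; [lia|lia|lia|rewrite ifT//; lia].
rewrite (hc q v.+1 k); last first.
  by move=> j jr; apply: tac; [lia|lia|lia|rewrite ifT//; lia].
rewrite (hc r k.+1 m); last first.
  by move=> j jr; apply: tac; [lia|lia|lia|rewrite ifF ?ifT//; lia].
rewrite (hc 1 m.+1 n); last first.
  by move=> j jr; apply: tac; [lia|lia|lia|rewrite !ifF//; lia].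
have -> : h v = p by rewrite /h eqxx.
have -> : h k = p by rewrite /h eqxx; case: ifP.
have -> : h m = p by rewrite /h eqxx; case: ifP => //; case: ifP.
have -> : k.-1 = (v + (k - v.+1))%N by lia.
have -> : (m - k).-1 = (m - k.+1)%N by lia.
rewrite subn0 expr1n exprD; ring.
Qed.

Section Mean.
Variables (R : realFieldType) (M : nat).
Let N := (M.*2).+1.
Let T := 'I_(M.*2).+1.
Implicit Types d e y : T.

(** Given a vertex at 0, a point y outside the ball around d that has 0 on its boundary
    does not prevent a point at d from being attached to 0. *)
Definition outside d y : bool := (cnorm d < cnorm (y - d))%N.

(** The probability that k and m are both attached to v, given that their positions
    relative to v are d and e. The k.-1 points other than v that precede k must be
    outside both balls, the points between k and m only outside the ball around e, and
    the point k itself must not be an obstacle between m and v. *)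
Definition both_attach (k m : nat) d e : R :=
  [&& d != 0, e != 0 & outside e d]%:R *
  ((\sum_(y : T) (outside d y && outside e y)%:R) / N%:R) ^+ k.-1 *
  ((\sum_(y : T) (outside e y)%:R) / N%:R) ^+ (m - k).-1.

Lemma mean_enum (phi : T -> R) : mean (enum T) phi = (\sum_y phi y) / N%:R.
Proof. by rewrite /mean size_enum_ord mulrC big_enum. Qed.

(** Once the positions of v, k and m are prescribed, the event is a product of conditions
    on single letters. Two factors N^-1 remain, as the position of v is irrelevant by
    translation. *)
Lemma mean_both_attach v k m n : (v < k)%N -> (k < m)%N -> (m < n)%N ->
  mean (words (fun=> enum T) n)
    (fun s => (child predT (nth 0 s) v k && child predT (nth 0 s) v m)%:R : R)
  = N%:R^-1 ^+ 2 * \sum_d \sum_e both_attach k m d e.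
Proof.
move=> vk km mn.
pose phi a d e (j : nat) (y : T) : bool :=
  if j == v then y == a else if j == k then y == a + d else if j == m then y == a + e
  else if (j < k)%N then outside d (y - a) && outside e (y - a)
  else if (j < m)%N then outside e (y - a) else true.
pose c d e : R := [&& d != 0, e != 0 & outside e d]%:R.
(* Sum over the positions a of v, a + d of k and a + e of m. *)
have dec s : (child predT (nth 0 s) v k && child predT (nth 0 s) v m)%:R =
    \sum_a \sum_d \sum_e c d e * \prod_(j < n) (phi a d e j (nth 0 s j))%:R.
  set x := nth 0 s.
  have out0 a d e j : (j < n)%N -> phi a d e j (x j) = false ->
      c d e * \prod_(j < n) (phi a d e j (nth 0 s j))%:R = 0.
    by move=> jn pj; rewrite (bigD1 (Ordinal jn))//= -/x pj mul0r mulr0.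
  rewrite (bigD1 (x v))//= [X in _ + X]big1 ?addr0; last first.
    move=> a av; rewrite big1// => d _; rewrite big1// => e _.
    apply: (out0 _ _ _ v); first by lia.
    by rewrite /phi eqxx; apply/negbTE; rewrite eq_sym.
  rewrite (bigD1 (x k - x v))//= [X in _ + X]big1 ?addr0; last first.
    move=> d dv; rewrite big1// => e _.
    apply: (out0 _ _ _ k); first by lia.
    rewrite /phi gtn_eqF// eqxx; apply: contraNF dv => /eqP->.
    by rewrite addrAC subrr add0r.
  rewrite (bigD1 (x m - x v))//= [X in _ + X]big1 ?addr0; last first.
    move=> e ev; apply: (out0 _ _ _ m); first by lia.
    have mv : (m == v) = false by lia.
    have mk : (m == k) = false by lia.
    by rewrite /phi mv mk eqxx; apply: contraNF ev => /eqP->; rewrite addrAC subrr add0r.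
  rewrite /c (prod_natr_bool _ _ (fun j => phi (x v) (x k - x v) (x m - x v) j (nth 0 s j))).
  rewrite -natrM mulnb; congr (nat_of_bool _)%:R.
  have oE (i j : nat) : outside (x j - x v) (x i - x v) =
      (cnorm (x v - x j) < cnorm (x i - x j))%N.
    by rewrite /outside cnormB opprB addrA subrK.
  apply/andP/andP.
    move=> [/childP[_ _ _ nvk hk] /childP[_ _ _ nvm hm]]; split.
      rewrite !subr_eq0 eq_sym nvk eq_sym nvm oE /=; apply: hm => //; lia.
    apply/allP => j; rewrite mem_iota add0n => /= jn; rewrite /phi -/x.
    case: eqVneq => [->//|jv]; case: eqVneq => [->|jk]; first by rewrite addrC subrK.
    case: eqVneq => [->|jm]; first by rewrite addrC subrK.
    case: ltnP => jk'; first by rewrite !oE hk// hm//; lia.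
    by case: ltnP => jm' //; rewrite oE hm//.
  rewrite !subr_eq0 oE => -[/and3P[nvk nvm hkm] /allP h].
  have hphi j : (j < n)%N -> phi (x v) (x k - x v) (x m - x v) j (x j).
    by move=> jn; apply: h; rewrite mem_iota.
  split; apply/childP; split=> //.
  - by rewrite eq_sym.
  - move=> j jk _ jv; have jn : (j < n)%N by lia.
    have jm : (j == m) = false by lia.
    by have := hphi j jn; rewrite /phi (negPf jv) jk jm (ltn_eqF jk) !oE => /andP[].
  - by lia.
  - by rewrite eq_sym.
  - move=> j jm _ jv; case: (eqVneq j k) => [->//|jk].
    have jn : (j < n)%N by lia.
    have := hphi j jn; rewrite /phi (negPf jv) (negPf jk) jm (ltn_eqF jm) !oE.
    by case: ltnP => // _ /andP[].
under eq_mean do rewrite dec.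
rewrite mean_sum.
transitivity (\sum_(a : T) \sum_d \sum_e N%:R^-1 ^+ 3 * both_attach k m d e); last first.
  have -> : \sum_d \sum_e N%:R^-1 ^+ 3 * both_attach k m d e =
      N%:R^-1 ^+ 3 * \sum_d \sum_e both_attach k m d e.
    by rewrite mulr_sumr; apply: eq_bigr => d _; rewrite mulr_sumr.
  by rewrite sumr_const card_ord -(mulr_natl (_ * _)) mulrA exprS mulrA mulfV ?mul1r ?pnatr_eq0.
apply: eq_bigr => a _; rewrite mean_sum; apply: eq_bigr => d _; rewrite mean_sum;
  apply: eq_bigr => e _.
rewrite meanZ (mean_words_prod _ 0 _ (fun j y => (phi a d e j y)%:R)) /both_attach -/(c d e).
have one b : mean (enum T) (fun y => (y == b)%:R) = N%:R^-1 :> R.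
  rewrite mean_enum (bigD1 b)//= eqxx big1 ?addr0 ?mul1r// => y /negPf->//.
rewrite (eq_bigr (fun j : 'I_n => (if j == v :> nat then N%:R^-1 else if j == k :> nat then
  N%:R^-1 else if j == m :> nat then N%:R^-1
     else if (j < k)%N then (\sum_(y : T) (outside d y && outside e y)%:R) / N%:R
       else if (j < m)%N then (\sum_(y : T) (outside e y)%:R) / N%:R else 1))); last first.
  move=> j _; rewrite /phi; do 3 case: eqP => _ //.
  case: ltnP => _.
    by rewrite mean_enum; congr (_ / _); rewrite (reindex_inj (addIr a))/=;
      under eq_bigr do rewrite addrK.
  case: ltnP => _.
    by rewrite mean_enum; congr (_ / _); rewrite (reindex_inj (addIr a))/=;
      under eq_bigr do rewrite addrK.
  by rewrite mean_cst// size_enum_ord.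
by rewrite prod_three_marked//; ring.
Qed.

Lemma sum_interval l h (b : T -> bool) : (h <= N)%N ->
  (forall y : T, b y = (l <= y < h)%N) -> \sum_(y : T) (b y)%:R = (h - l)%:R :> R.
Proof.
move=> hN bE; under eq_bigr do rewrite bE.
rewrite -natr_sum -(big_mkord xpredT (fun r : nat => (l <= r < h)%N : nat)); congr (_%:R).
rewrite (sum_pred_count (fun r : nat => (l <= r < h)%N)).
have [lh|hl] := leqP l h; last first.
  have -> : (h - l = 0)%N by lia.
  by apply/eqP; rewrite -leqn0 leqNgt -has_count -all_predC; apply/allP => y _ /=; lia.
have -> : iota 0 (M.*2).+1 = iota 0 (l + ((h - l) + (N - h))).
  by congr iota; rewrite /N in hN *; lia.
rewrite !iotaD !count_cat add0n.
have z a c : (forall r : nat, (a <= r < a + c)%N -> ~~ (l <= r < h)%N) ->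
    count (fun r : nat => l <= r < h)%N (iota a c) = 0%N.
  move=> hy; apply/eqP; rewrite -leqn0 leqNgt -has_count -all_predC; apply/allP => y.
  by rewrite mem_iota; exact: hy.
rewrite (z 0%N l); last by move=> r; lia.
rewrite (z (l + (h - l))%N (N - h)%N); last by move=> r; lia.
rewrite add0n addn0 -[RHS](size_iota l); apply/eqP; rewrite -all_count; apply/allP => y.
by rewrite mem_iota; lia.
Qed.

Let pos (s : nat) : T := inord s.

Lemma val_pos s : (s <= M)%N -> nat_of_ord (pos s) = s.
Proof. by move=> sM; rewrite /= inordK//; lia. Qed.

Lemma sum_sides (F : T -> R) : F 0 = 0 ->
  \sum_d F d = \sum_(1 <= s < M.+1) (F (pos s) + F (- pos s)).
Proof.
move=> F0; rewrite [LHS](_ : _ = \sum_(d : T) F (inord (val d))); last first.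
  by apply: eq_bigr => d _; rewrite inord_val.
rewrite -(big_mkord xpredT (fun d : nat => F (inord d))) /N.
rewrite big_nat_recl// (_ : inord 0 = 0) ?F0 ?add0r; last first.
  by apply: val_inj; rewrite /= inordK.
rewrite big_split /= (big_cat_nat (leq0n M)); last by lia.
congr (_ + _); first by rewrite big_add1.
have shift (G : nat -> R) : \sum_(M <= i < M.*2) G i = \sum_(0 <= i < M) G (i + M)%N.
  by rewrite -{1}(add0n M) big_addn -addnn addnK.
rewrite (shift (fun i => F (inord i.+1))) big_nat_rev /= add0n [RHS]big_add1 /=.
apply: eq_big_nat => i iM; congr (F _); apply: val_inj.
have i1M : (i.+1 <= M)%N by lia.
by rewrite val_oppI /= val_pos//= inordK; lia.
Qed.

Lemma outside_right s y : (0 < s <= M)%N -> outside (pos s) y = (2 * s < y)%N.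
Proof.
move=> sM; rewrite /outside /cnorm val_subI val_pos; last by lia.
have := ltn_ord y; case: ifP; lia.
Qed.

Lemma outside_opp d y : outside (- d) (- y) = outside d y.
Proof. by rewrite /outside cnormN -opprD cnormN. Qed.

Lemma outside_left s y : (0 < s <= M)%N -> outside (- pos s) y = (0 < y < N - 2 * s)%N.
Proof.
move=> sM; rewrite -[y]opprK outside_opp outside_right// val_oppI opprK.
rewrite /N; have := ltn_ord y; case: eqP => /= [->|]; lia.
Qed.

Lemma both_attach_opp k m d e : both_attach k m (- d) (- e) = both_attach k m d e.
Proof.
rewrite /both_attach !oppr_eq0 outside_opp.
rewrite (reindex_inj oppr_inj) [X in _ * _ * (X / _) ^+ _](reindex_inj oppr_inj) /=.
by congr (_ * (_ / _) ^+ _ * (_ / _) ^+ _); apply: eq_bigr => y _; rewrite !outside_opp.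
Qed.

(** The condition on the point k is 2 * u < s, and then the ball around u is contained in
    the one around s. *)
Lemma both_attach_same k m s u : (0 < s <= M)%N -> (0 < u <= M)%N ->
  both_attach k m (pos s) (pos u) = (2 * u < s)%:R *
   ((2 * (M - s))%:R / N%:R) ^+ k.-1 * ((2 * (M - u))%:R / N%:R) ^+ (m - k).-1.
Proof.
move=> sM uM; rewrite /both_attach.
have n0 t : (0 < t <= M)%N -> (pos t != 0).
  by move=> tM; rewrite -val_eqE /= val_pos; lia.
rewrite !n0// outside_right// val_pos ?(proj2 (andP sM))//=.
case: ltnP => us; last by rewrite !mul0r.
rewrite (@sum_interval (2 * s).+1 N)//; last first.
  move=> y; rewrite !outside_right//; have := ltn_ord y; lia.
rewrite (@sum_interval (2 * u).+1 N)//; last first.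
  move=> y; rewrite !outside_right//; have := ltn_ord y; lia.
by congr (_ * (_%:R / _) ^+ _ * (_%:R / _) ^+ _); rewrite /N; lia.
Qed.

(** The balls are disjoint unless they cover the whole group, in which case the factor
    with exponent k.-1 vanishes. This is where k must have a predecessor besides v. *)
Lemma both_attach_opposite k m s u : (1 < k)%N -> (0 < s <= M)%N -> (0 < u <= M)%N ->
  both_attach k m (pos s) (- pos u) =
   ((2 * (M - s - u))%:R / N%:R) ^+ k.-1 * ((2 * (M - u))%:R / N%:R) ^+ (m - k).-1.
Proof.
move=> k1 sM uM; rewrite /both_attach.
have n0 t : (0 < t <= M)%N -> (pos t != 0).
  by move=> tM; rewrite -val_eqE /= val_pos; lia.
rewrite oppr_eq0 !n0// outside_left// val_pos ?(proj2 (andP sM))//=.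
rewrite (@sum_interval (2 * s).+1 (N - 2 * u)); [|by lia|]; last first.
  move=> y; rewrite outside_right// outside_left//; have := ltn_ord y; lia.
rewrite (@sum_interval 1 (N - 2 * u)); [|by lia|]; last first.
  by move=> y; rewrite outside_left//.
have -> : (N - 2 * u - (2 * s).+1 = 2 * (M - s - u))%N by rewrite /N; lia.
have -> : (N - 2 * u - 1 = 2 * (M - u))%N by rewrite /N; lia.
have [lt|] := ltnP (s + u) M; first by rewrite (_ : (0 < s < N - 2 * u)%N = true) ?mul1r// /N; lia.
move=> h; have -> : (M - s - u = 0)%N by lia.
by rewrite muln0 mul0r expr0n (_ : k.-1 == 0%N = false) ?(mulr0, mul0r)//; lia.
Qed.

Definition power_sum (p R' : nat) : R := \sum_(0 <= r < R') (r%:R) ^+ p.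

(** Sum over the distances s of k and u of m, with w = M - u. On the same side M - s runs
    through the numbers below 2 * w - M, on opposite sides M - s - u runs through those
    below w; the factor 2 is the choice of the side of m. *)
Lemma mean_both_attachE v k m n : (v < k)%N -> (1 < k)%N -> (k < m)%N -> (m < n)%N ->
  mean (words (fun=> enum T) n)
    (fun s => (child predT (nth 0 s) v k && child predT (nth 0 s) v m)%:R : R)
  = 2 * N%:R^-1 ^+ 2 * (2 / N%:R) ^+ (m - 2) *
    \sum_(0 <= w < M) w%:R ^+ (m - k).-1 *
       (power_sum k.-1 (2 * w - M) + power_sum k.-1 w).
Proof.
move=> vk k1 km mn; rewrite mean_both_attach//.
have b0 e : both_attach k m 0 e = 0 by rewrite /both_attach eqxx !mul0r.
have b0' d : both_attach k m d 0 = 0 by rewrite /both_attach eqxx andbF !mul0r.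
rewrite sum_sides; last by rewrite big1.
have -> : \sum_(1 <= s < M.+1) (\sum_e both_attach k m (pos s) e + \sum_e both_attach k m (- pos
  s) e)
  = 2 * \sum_(1 <= s < M.+1) \sum_(1 <= u < M.+1)
      (both_attach k m (pos s) (pos u) + both_attach k m (pos s) (- pos u)).
  rewrite mulr_sumr; apply: eq_bigr => s _.
  have -> : \sum_e both_attach k m (- pos s) e = \sum_e both_attach k m (pos s) e.
    by rewrite (reindex_inj oppr_inj); apply: eq_bigr => e _; rewrite /= both_attach_opp.
  by rewrite -mulr2n mulr_natl sum_sides ?b0'.
rewrite [LHS]mulrCA -!mulrA; congr (_ * (_ * (_ * _))).
rewrite exchange_big /= big_add1 big_nat_rev /= add0n mulr_sumr.
apply: eq_big_nat => w wM.
have -> : (M - w.+1).+1 = (M - w)%N by lia.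
have uM : (0 < M - w <= M)%N by lia.
rewrite big_split /= !mulrDr.
have ex : ((2 / N%:R) ^+ (m - 2) : R) = (2 / N%:R) ^+ (m - k).-1 * (2 / N%:R) ^+ k.-1.
  by rewrite -exprD; congr (_ ^+ _); lia.
have ps (q : nat) (g : nat -> R) : (q <= M)%N ->
    \sum_(1 <= s < M.+1) (g s) = \sum_(1 <= s < q.+1) g s + \sum_(q.+1 <= s < M.+1) g s.
  by move=> qM; rewrite (@big_cat_nat _ _ _ q.+1)//; lia.
have W : (2 * (M - (M - w)))%:R / N%:R = 2 / N%:R * w%:R :> R.
  by rewrite (_ : M - (M - w) = w)%N ?natrM; [rewrite mulrAC|lia].
congr (_ + _).
  rewrite (ps (minn M (2 * (M - w)))) ?geq_minl// [X in X + _]big_nat big1 ?add0r; last first.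
    move=> s sw; rewrite both_attach_same//; last by lia.
    by rewrite (_ : _ < _ = false)%N ?mul0r//; lia.
  transitivity (\sum_(0 <= r < 2 * w - M) (2 / N%:R * r%:R) ^+ k.-1 * (2 / N%:R * w%:R) ^+ (m -
    k).-1 : R).
    have -> : (2 * w - M = M - minn M (2 * (M - w)))%N by lia.
    set q := minn _ _; have qM : (q <= M)%N by rewrite geq_minl.
    rewrite -{1}(add0n q.+1) big_addn subSS big_nat_rev/= add0n; apply: eq_big_nat => r rq.
    rewrite both_attach_same//; last by lia.
    rewrite W (_ : _ < _ = true)%N ?mul1r; last by lia.
    congr (_ ^+ _ * _); rewrite (_ : M - _ = r)%N ?natrM; [by rewrite mulrAC|lia].
  rewrite /power_sum ex -mulr_suml; set c : R := 2 / N%:R.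
  under eq_bigr do rewrite exprMn; rewrite -mulr_sumr !exprMn; ring.
rewrite (ps w); last by lia.
rewrite [X in _ + X]big_nat [X in _ + X]big1 ?addr0; last first.
  move=> s sw; rewrite both_attach_opposite//; last by lia.
  rewrite (_ : M - s - _ = 0)%N; last by lia.
  by rewrite muln0 mul0r expr0n (_ : k.-1 == 0%N = false) ?mul0r//; lia.
transitivity (\sum_(0 <= r < w) (2 / N%:R * r%:R) ^+ k.-1 * (2 / N%:R * w%:R) ^+ (m - k).-1 : R).
  rewrite big_add1 big_nat_rev/= add0n; apply: eq_big_nat => r rq.
  rewrite both_attach_opposite//; last by lia.
  rewrite W.
  congr (_ ^+ _ * _); rewrite (_ : M - _ - _ = r)%N ?natrM; [by rewrite mulrAC|lia].
rewrite /power_sum ex -mulr_suml; set c : R := 2 / N%:R.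
under eq_bigr do rewrite exprMn; rewrite -mulr_sumr !exprMn; ring.
Qed.

End Mean.

(** * Mean number of sibling pairs in a cyclic group: asymptotics *)

Section PowerSums.
Variable R : realFieldType.
Implicit Types x : R.

Lemma exprD1_ge x k : 0 <= x -> x ^+ k.+1 + k.+1%:R * x ^+ k <= (x + 1) ^+ k.+1.
Proof.
move=> x0; elim: k => [|k IH]; first by rewrite !expr1 expr0 mulr1.
rewrite [leRHS]exprS; apply: le_trans (ler_wpM2l _ IH); last by lra.
have := exprn_ge0 k x0; have : 0 <= k.+1%:R :> R by [].
rewrite -[k.+2%:R]natr1 ![x ^+ _.+1]exprS; nra.
Qed.

Lemma exprB1_ge x k : 1 <= x -> x ^+ k.+1 - k.+1%:R * x ^+ k <= (x - 1) ^+ k.+1.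
Proof.
move=> x1; elim: k => [|k IH]; first by rewrite !expr1 expr0 mulr1.
rewrite [leRHS]exprS; apply: le_trans (ler_wpM2l _ IH); last by lra.
have := exprn_ge0 k (le_trans ler01 x1); have : 0 <= k.+1%:R :> R by [].
rewrite -[k.+2%:R]natr1 ![x ^+ _.+1]exprS; nra.
Qed.

(** Both bounds telescope, by the tangent inequalities for powers. *)
Lemma power_sum_bounds p n :
  n%:R ^+ p.+1 - p.+1%:R * n%:R ^+ p <= p.+1%:R * power_sum R p n <= n%:R ^+ p.+1.
Proof.
rewrite /power_sum; apply/andP; split; last first.
  elim: n => [|n IH]; first by rewrite big_geq// mulr0 expr0n.
  rewrite big_nat_recr//= mulrDr -[n.+1%:R]natr1.
  have := exprD1_ge p (ler0n R n); lra.
rewrite lerBlDr -mulrDr; elim: n => [|n IH].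
  by rewrite big_geq// add0r [leLHS]expr0n mulr_ge0 ?exprn_ge0.
rewrite big_nat_recr//= mulrDr.
have n1 : 1 <= n.+1%:R :> R by rewrite ler1n.
have := exprB1_ge p n1; rewrite -[in X in _ <= X](natr1 n) addrK; lra.
Qed.

Lemma geometric_mix x y m : (0 < m)%N ->
  (x - y) * (\sum_(1 <= k < m) x ^+ (m - k).-1 * y ^+ k) = x ^+ m.-1 * y - y ^+ m.
Proof.
case: m => // m _; elim: m => [|m IH].
  by rewrite big_geq// mulr0 expr0 expr1 mul1r subrr.
rewrite big_nat_recr//= subSnn /= expr0 mul1r.
rewrite [X in _ * (X + _)](_ : _ = x * \sum_(1 <= i < m.+1) x ^+ (m.+1 - i).-1 * y ^+ i).
  by rewrite mulrDr mulrCA IH /= ![_ ^+ _.+1]exprS; ring.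
rewrite mulr_sumr; apply: eq_big_nat => k /andP[k1 km]; rewrite mulrA -exprS.
by congr (_ ^+ _ * _); lia.
Qed.

(** The Riemann sum with M terms for the integral of x ^+ p over the unit interval. *)
Definition power_mean (M p : nat) : R := M%:R^-1 * \sum_(0 <= w < M) (w%:R / M%:R) ^+ p.

Lemma power_meanE M p : power_mean M p = M%:R^-1 ^+ p.+1 * power_sum R p M.
Proof.
rewrite /power_mean /power_sum exprS -mulrA; congr (_ * _); rewrite mulr_sumr.
by apply: eq_bigr => w _; rewrite exprMn mulrC.
Qed.

Lemma power_mean_bounds M p : (0 < M)%N -> p.+1%:R^-1 - M%:R^-1 <= power_mean M p <= p.+1%:R^-1.
Proof.
move=> M0; have M0' : 0 < M%:R :> R by rewrite ltr0n.
have p0 : 0 < p.+1%:R :> R by [].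
have /andP[h1 h2] := power_sum_bounds p M.
have e : M%:R^-1 ^+ p.+1 * M%:R ^+ p.+1 = 1 :> R by rewrite -exprMn mulVf ?expr1n// gt_eqF.
have e' : M%:R^-1 ^+ p.+1 * M%:R ^+ p = M%:R^-1 :> R.
  by rewrite exprS -mulrA -exprMn mulVf ?expr1n ?mulr1// gt_eqF.
have w0 : 0 <= M%:R^-1 ^+ p.+1 :> R by rewrite exprn_ge0// invr_ge0.
rewrite power_meanE; set c := M%:R^-1 ^+ p.+1 in e e' w0 *.
have ee : p.+1%:R * p.+1%:R^-1 = 1 :> R by rewrite mulfV// gt_eqF.
apply/andP; split.
  rewrite -(ler_pM2l p0) mulrBr ee.
  by have := ler_wpM2l w0 h1; rewrite mulrBr e [c * (_ * _ ^+ _)]mulrCA e' [c * (_ * power_sum _ _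
    _)]mulrCA.
rewrite -(ler_pM2l p0) ee.
by have := ler_wpM2l w0 h2; rewrite e [c * (_ * power_sum _ _ _)]mulrCA.
Qed.

Lemma power_mean_ge0 M p : 0 <= power_mean M p.
Proof.
by rewrite /power_mean mulr_ge0 ?invr_ge0// sumr_ge0// => i _; rewrite exprn_ge0// divr_ge0.
Qed.

End PowerSums.

Section MeanAsymptotics.
Variables (R : realFieldType) (H : nat).
Hypothesis H0 : (0 < H)%N.
Let M := H.*2.
Let N := (M.*2).+1.
Let a (w : nat) : R := w%:R / M%:R.
Let b (w : nat) : R := (2 * w - M)%:R / M%:R.

Let M0 : 0 < M%:R :> R. Proof. by rewrite ltr0n double_gt0. Qed.

Let a_ge0 w : 0 <= a w. Proof. by rewrite divr_ge0. Qed.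
Let b_ge0 w : 0 <= b w. Proof. by rewrite divr_ge0. Qed.
Let a_le1 w : (w < M)%N -> a w <= 1.
Proof. by move=> wM; rewrite ler_pdivrMr// mul1r ler_nat ltnW. Qed.
Let b_le1 w : (w < M)%N -> b w <= 1.
Proof. by move=> wM; rewrite ler_pdivrMr// mul1r ler_nat; lia. Qed.

(** The Riemann sum of the density of pairs of siblings k, m in the variable a = 1 - u,
    up to the factor theta ^+ m / 2 of pair_rate_riemann; here u is the distance of m
    to the parent, rescaled to the unit interval. The term in b, the positive part of
    2 * a - 1, corresponds to the same side of the parent, the other one to opposite
    sides. *)
Definition riemann_pair (m k : nat) : R :=
  M%:R^-1 * \sum_(0 <= w < M) a w ^+ (m - k).-1 * (b w ^+ k + a w ^+ k).

(** The probability that k and m are both attached to v, in the form given by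
    mean_both_attachE; it is the same for all v. *)
Definition pair_rate (m k : nat) : R :=
  2 * N%:R^-1 ^+ 2 * (2 / N%:R) ^+ (m - 2) *
    \sum_(0 <= w < M) w%:R ^+ (m - k).-1 *
       (power_sum R k.-1 (2 * w - M) + power_sum R k.-1 w).

Lemma riemann_pair_bounds m k : 0 <= riemann_pair m k <= 2.
Proof.
rewrite /riemann_pair; apply/andP; split.
  rewrite mulr_ge0 ?invr_ge0//; apply: sumr_ge0 => w _.
  by rewrite mulr_ge0 ?addr_ge0 ?exprn_ge0.
rewrite ler_pdivrMl//; apply: (@le_trans _ _ (\sum_(0 <= w < M) 2)); last first.
  by rewrite big_const_nat subn0 iter_addr addr0 -[_ *+ M]mulr_natl.
apply: ler_sum_nat => w /andP[_ wM].
rewrite -[leRHS]mul1r; apply: ler_pM; rewrite ?addr_ge0 ?exprn_ge0//.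
  by rewrite exprn_ile1 ?a_le1.
have := exprn_ile1 k (a_ge0 w) (a_le1 wM); have := exprn_ile1 k (b_ge0 w) (b_le1 wM); lra.
Qed.

Let theta : R := 2 * M%:R / N%:R.

(** The factor k is the number of possible parents. It turns the power sums into powers,
    up to an error of order k / M; the power of theta comes from N = 2 * M + 1. *)
Lemma pair_rate_riemann m k : (0 < k < m)%N -> (1 < m)%N ->
  theta ^+ m / 2 * (riemann_pair m k - 2 * k%:R / M%:R) <= k%:R * pair_rate m k
  <= theta ^+ m / 2 * riemann_pair m k.
Proof.
move=> /andP[k0 km] m1.
have N0 : 0 < N%:R :> R by rewrite ltr0n.
have th0 : 0 <= theta ^+ m / 2.
  by rewrite divr_ge0// exprn_ge0// divr_ge0// mulr_ge0.
have nM : M%:R != 0 :> R by rewrite gt_eqF.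
have nN : N%:R != 0 :> R by rewrite gt_eqF.
have E : k%:R * pair_rate m k = theta ^+ m / 2 * (M%:R^-1 *
   \sum_(0 <= w < M) a w ^+ (m - k).-1 *
     (M%:R^-1 ^+ k * (k%:R * power_sum R k.-1 (2 * w - M)) +
      M%:R^-1 ^+ k * (k%:R * power_sum R k.-1 w))).
  rewrite /pair_rate.
  rewrite (_ : 2 * N%:R^-1 ^+ 2 * (2 / N%:R) ^+ (m - 2) = theta ^+ m / 2 * M%:R^-1 ^+ m);
    last first.
    rewrite /theta -{2 3}(subnK m1) mulrAC exprMn !exprD !exprMn !exprVn.
    by field; rewrite nN nM !expf_neq0.
  rewrite mulrCA -!mulrA; congr (_ * (_ * _)); rewrite !mulr_sumr; apply: eq_bigr => w _.
  have -> : M%:R^-1 ^+ m = M%:R^-1 * M%:R^-1 ^+ (m - k).-1 * M%:R^-1 ^+ k :> R.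
    by rewrite -exprS -exprD; congr (_ ^+ _); lia.
  rewrite /a exprMn; ring.
have bd c : (c <= M)%N -> (c%:R / M%:R) ^+ k - k%:R / M%:R <=
    M%:R^-1 ^+ k * (k%:R * power_sum R k.-1 c) <= (c%:R / M%:R) ^+ k.
  move=> cM; have := power_sum_bounds R k.-1 c; rewrite prednK// => /andP[h1 h2].
  have w0 : 0 <= M%:R^-1 ^+ k :> R by rewrite exprn_ge0// invr_ge0.
  rewrite exprMn (mulrC (c%:R ^+ k)); apply/andP; split; last exact: ler_wpM2l.
  apply: le_trans (ler_wpM2l w0 h1); rewrite mulrBr lerD2l lerN2 mulrCA ler_wpM2l//.
  rewrite -{1}(prednK k0) exprS -mulrA -exprMn -[leRHS]mulr1 ler_wpM2l ?invr_ge0//.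
  rewrite mulrC exprn_ile1 ?divr_ge0//.
  by rewrite ler_pdivrMr// mul1r ler_nat.
rewrite E /riemann_pair; apply/andP; split; apply: ler_wpM2l => //; last first.
  apply: ler_wpM2l; first by rewrite invr_ge0.
  apply: ler_sum_nat => w /andP[_ wM]; apply: ler_wpM2l; first by rewrite exprn_ge0.
  have /bd/andP[_ h1] : (2 * w - M <= M)%N by lia.
  by have /bd/andP[_ h2] := ltnW wM; apply: lerD.
rewrite lerBlDl.
have -> : 2 * k%:R / M%:R = M%:R^-1 * \sum_(0 <= w < M) 2 * k%:R / M%:R :> R.
  rewrite big_const_nat subn0 iter_addr addr0 -[_ *+ M]mulr_natr; field; exact: nM.
rewrite -mulrDr; apply: ler_wpM2l; first by rewrite invr_ge0.
rewrite -big_split; apply: ler_sum_nat => w /andP[_ wM] /=.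
have /bd/andP[h1 _] : (2 * w - M <= M)%N by lia.
have /bd/andP[h2 _] := ltnW wM.
rewrite -/(a w) -/(b w) in h1 h2.
set p1 := _ * (_ * power_sum _ _ (2 * w - M)) in h1 *; set p2 := _ * (_ * power_sum _ _ w) in h2 *.
have c1 : a w ^+ (m - k).-1 <= 1 by rewrite exprn_ile1 ?a_le1.
have c0 : 0 <= a w ^+ (m - k).-1 by rewrite exprn_ge0.
have e0 : 0 <= k%:R / M%:R :> R by rewrite divr_ge0.
set c := a w ^+ (m - k).-1 in c0 c1 *; set e := k%:R / M%:R in e0 h1 h2 *.
rewrite -mulrA -/e.
have : c * (b w ^+ k + a w ^+ k) <= c * (2 * e + (p1 + p2)) by apply: ler_wpM2l => //; lra.
have : c * (2 * e) <= 2 * e by rewrite ler_piMl// mulr_ge0.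
by rewrite mulrDr; lra.
Qed.

Lemma theta_pow m : 1 - m%:R / N%:R <= theta ^+ m <= 1.
Proof.
have N0 : 0 < N%:R :> R by rewrite ltr0n.
have nN : N%:R != 0 :> R by rewrite gt_eqF.
have tE : theta = 1 - N%:R^-1.
  have : N%:R = 2 * M%:R + 1 :> R by rewrite /N -natr1 -muln2 natrM mulrC.
  move=> e; apply: (mulIf nN); rewrite mulrBl mulVf// /theta divfK// mul1r e; lra.
have i0 : 0 <= N%:R^-1 :> R by rewrite invr_ge0.
have i1 : N%:R^-1 <= 1 :> R by rewrite invf_le1// ler1n.
have t0 : 0 <= theta by rewrite tE; lra.
have t1 : theta <= 1 by rewrite tE; lra.
apply/andP; split; last by rewrite exprn_ile1.
elim: m => [|m IH]; first by rewrite mul0r subr0 expr0.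
rewrite exprS -natr1 mulrDl mul1r.
have := exprn_ile1 m t0 t1; have := exprn_ge0 m t0; rewrite tE in IH *.
set x := (1 - _) ^+ m in IH *; nra.
Qed.

Definition sibling_rate m : R := \sum_(2 <= k < m) k%:R * pair_rate m k.
Definition riemann_rate m : R := \sum_(2 <= k < m) riemann_pair m k.

Lemma sibling_rate_riemann m : (1 < m)%N ->
  `|sibling_rate m - riemann_rate m / 2| <= 2 * m%:R ^+ 2 / M%:R.
Proof.
move=> m1.
have N0 : 0 < N%:R :> R by rewrite ltr0n.
have NM : M%:R <= N%:R :> R by rewrite ler_nat; lia.
have /andP[t1 t2] := theta_pow m.
have t0 : 0 <= theta ^+ m by rewrite exprn_ge0// divr_ge0// mulr_ge0.
have sz : \sum_(2 <= k < m) (2 * m%:R / M%:R) <= 2 * m%:R ^+ 2 / M%:R :> R.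
  rewrite big_const_nat iter_addr addr0 -[_ *+ _]mulr_natr expr2.
  rewrite (_ : 2 * (m%:R * m%:R) / M%:R = 2 * m%:R / M%:R * m%:R); last by ring.
  by apply: ler_wpM2l; rewrite ?divr_ge0 ?mulr_ge0// ler_nat leq_subr.
rewrite /sibling_rate /riemann_rate mulr_suml -sumrB.
apply: le_trans (ler_norm_sum _ _ _) (le_trans _ sz); apply: ler_sum_nat => k /andP[k2 km].
have kk : (0 < k < m)%N by lia.
have /andP[h1 h2] := pair_rate_riemann kk m1.
have /andP[r0 r2] := riemann_pair_bounds m k.
set t := theta ^+ m in t0 t1 t2 h1 h2 *; set q := riemann_pair m k in r0 r2 h1 h2 *.
have dm : k%:R / M%:R <= m%:R / M%:R :> R by rewrite ler_wpM2r ?invr_ge0// ler_nat ltnW.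
have dN : m%:R / N%:R <= m%:R / M%:R :> R.
  by rewrite ler_wpM2l// lef_pV2 ?posrE.
have k0 : 0 <= k%:R / M%:R :> R by rewrite divr_ge0.
rewrite -(mulrA 2 k%:R) in h1; rewrite -(mulrA 2 m%:R); set km' := k%:R / M%:R in h1 dm k0;
  set mm := m%:R / M%:R in dm dN *.
set mn := m%:R / N%:R in dN t1.
have h3 : t / 2 * (2 * km') <= mm.
  by have := ler_wpM2r k0 t2; lra.
have h4 : (1 - t) * q <= 2 * mm.
  apply: (@le_trans _ _ ((1 - t) * 2)); first by rewrite ler_wpM2l// subr_ge0.
  lra.
have h5 : t * q <= q by rewrite ler_piMl.
rewrite ler_norml; apply/andP; split; lra.
Qed.

Definition same_side_limit m : R := \sum_(1 <= i < m) (1 - 2^-1 ^+ i) * (i%:R^-1 - i.+1%:R^-1).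

(** The same-side part of riemann_pair, summed over all k; its limit for large M is
    same_side_limit. *)
Definition same_side m : R :=
  M%:R^-1 * \sum_(0 <= w < M) \sum_(1 <= k < m) a w ^+ (m - k).-1 * b w ^+ k.

(** Summing over k by geometric_mix leaves a combination of powers of a and b in the
    increment. Only the range w >= H matters, since b vanishes below; there the sums of
    powers of a are differences of two full Riemann sums. *)
Lemma same_sideS m : (0 < m)%N -> same_side m.+1 - same_side m =
  power_mean R H m - 2 * (power_mean R M m - 2^-1 ^+ m.+1 * power_mean R H m) +
    (power_mean R M m.-1 - 2^-1 ^+ m * power_mean R H m.-1).
Proof.
move=> m0.
have nH : H%:R != 0 :> R by rewrite pnatr_eq0 -lt0n.
have MH : M%:R = 2 * H%:R :> R by rewrite /M -muln2 natrM mulrC.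
have b0 w : (w < H)%N -> b w = 0.
  by move=> wH; rewrite /b (_ : 2 * w - M = 0)%N ?mul0r//; lia.
(* Over the upper half of the range, sums of powers of a are differences of Riemann sums,
   and sums of powers of b are Riemann sums with H terms. *)
have upper p : power_mean R M p - 2^-1 ^+ p.+1 * power_mean R H p = M%:R^-1 * \sum_(H <= w < M) a
  w ^+ p.
  rewrite {1}/power_mean (@big_cat_nat _ _ _ H) //=; last by lia.
  rewrite mulrDr addrAC -[RHS]add0r; congr (_ + _); apply/eqP; rewrite subr_eq0; apply/eqP.
  rewrite /power_mean mulrA MH !mulr_sumr; apply: eq_bigr => w _.
  rewrite !exprMn exprS invfM; rewrite !exprMn; field; rewrite nH; done.
have lower : power_mean R H m = 2 * M%:R^-1 * \sum_(H <= w < M) b w ^+ m.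
  rewrite /power_mean MH; rewrite (_ : 2 * (2 * H%:R)^-1 = H%:R^-1); last by field.
  have shift (G : nat -> R) : \sum_(H <= i < M) G i = \sum_(0 <= i < H) G (i + H)%N.
    by rewrite -{1}(add0n H) big_addn /M -addnn addnK.
  rewrite shift; congr (_ * _); apply: eq_big_nat => w _.
  rewrite /b (_ : 2 * (w + H) - M = 2 * w)%N; last by lia.
  by rewrite natrM MH; congr (_ ^+ _); field.
have upper' := upper m.-1; rewrite prednK // in upper'.
rewrite upper upper' lower /same_side.
have half (F : nat -> nat -> R) p : 
   \sum_(0 <= w < M) \sum_(1 <= k < p) F w k * b w ^+ k = \sum_(H <= w < M) \sum_(1 <= k < p) F w
     k * b w ^+ k.
  rewrite (@big_cat_nat _ _ _ H)//=; last by lia.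
  rewrite big_nat big1 ?add0r// => w /andP[_ wH]; rewrite big_nat big1// => k /andP[k1 _].
  by rewrite b0// expr0n; case: k k1 => // k _; rewrite mulr0.
rewrite (half (fun w k => a w ^+ (m.+1 - k).-1)) (half (fun w k => a w ^+ (m - k).-1)).
set A0 := \sum_(H <= w < M) a w ^+ m; set A1 := \sum_(H <= w < M) a w ^+ m.-1.
set B0 := \sum_(H <= w < M) b w ^+ m.
transitivity (M%:R^-1 * (2 * B0 - 2 * A0 + A1)); last by ring.
rewrite -mulrBr -sumrB; congr (_ * _); rewrite /A0 /A1 /B0.
rewrite !mulr_sumr -sumrB -big_split; apply: eq_big_nat => w /andP[Hw wM] /=.
have ab : b w = 2 * a w - 1.
  rewrite /a /b natrB; last by lia.
  by rewrite natrM; field; rewrite gt_eqF.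
rewrite big_nat_recr//= subSnn /= expr0 mul1r.
pose S := \sum_(1 <= k < m) a w ^+ (m - k).-1 * b w ^+ k.
have -> : \sum_(1 <= k < m) a w ^+ (m.+1 - k).-1 * b w ^+ k = a w * S.
  rewrite mulr_sumr; apply: eq_big_nat => k /andP[k1 km]; rewrite mulrA -exprS.
  by congr (_ ^+ _ * _); lia.
rewrite -/S.
have tel := geometric_mix (a w) (b w) m0; rewrite -/S in tel.
have am : a w ^+ m = a w * a w ^+ m.-1 by rewrite -exprS prednK.
have xb : a w ^+ m.-1 * b w = 2 * (a w * a w ^+ m.-1) - a w ^+ m.-1 by rewrite ab; ring.
have aS : (a w - b w) * S = S - a w * S by rewrite ab; ring.
rewrite am; lra.
Qed.

Lemma same_side_close m : (0 < m)%N -> `|same_side m - same_side_limit m| <= 8 * m%:R / M%:R.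
Proof.
elim: m => // -[_ _|m IH _].
  have -> : same_side_limit 1 = 0 by rewrite /same_side_limit big_geq.
  rewrite /same_side big1 => [|w _]; last by rewrite big_geq.
  by rewrite mulr0 subrr normr0 divr_ge0// mulr_ge0.
have := IH isT.
have -> : same_side_limit m.+2 = same_side_limit m.+1 + (1 - 2^-1 ^+ m.+1) * (m.+1%:R^-1 -
  m.+2%:R^-1).
  by rewrite /same_side_limit big_nat_recr.
have -> : 8 * m.+2%:R / M%:R = 8 * m.+1%:R / M%:R + 8 * M%:R^-1 :> R.
  by rewrite -[m.+2%:R]natr1; ring.
have := same_sideS (ltn0Sn m); rewrite [m.+1.-1]/=.
have M0n : (0 < M)%N by rewrite double_gt0.
have /andP[r1 r2] := power_mean_bounds R m.+1 M0n; have /andP[r3 r4] := power_mean_bounds R m M0n.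
have /andP[s1 s2] := power_mean_bounds R m.+1 H0; have /andP[s3 s4] := power_mean_bounds R m H0.
have HM : H%:R^-1 = 2 / M%:R :> R.
  rewrite /M -muln2 natrM; field; by rewrite pnatr_eq0 -lt0n.
have e0 : 0 <= M%:R^-1 :> R by rewrite invr_ge0.
rewrite HM in s1 s3.
have p0 : 0 <= 2^-1 ^+ m.+1 :> R by rewrite exprn_ge0 // invr_ge0.
have p1 : 2^-1 ^+ m.+1 <= 2^-1 :> R by rewrite exprS; apply: ler_piMr; [lra|apply: exprn_ile1; lra].
rewrite [2^-1 ^+ m.+2]exprS.
set e := M%:R^-1 in e0 r1 r3 s1 s3 *; set p := 2^-1 ^+ m.+1 in p0 p1 *.
move=> dE; rewrite !ler_norml => /andP[i1 i2].
have {}dE : same_side m.+2 = same_side m.+1 + (power_mean R H m.+1 - 2 * (power_mean R M m.+1 -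
  2^-1 * p * power_mean R H m.+1) +
      (power_mean R M m - p * power_mean R H m)) by rewrite -dE; lra.
rewrite dE.
move: i1 i2; set c8 := 8 * m.+1%:R * e => i1 i2.
set u1 := m.+1%:R^-1 in r3 r4 s3 s4 *; set u2 := m.+2%:R^-1 in r1 r2 s1 s2 *.
have q1 : 0 <= p * (u2 - power_mean R H m.+1) by rewrite mulr_ge0// subr_ge0.
have q2 : p * (u2 - power_mean R H m.+1) <= 2^-1 * (2 * e).
  by apply: ler_pM => //; lra.
have q3 : 0 <= p * (u1 - power_mean R H m) by rewrite mulr_ge0// subr_ge0.
have q4 : p * (u1 - power_mean R H m) <= 2^-1 * (2 * e).
  by apply: ler_pM => //; lra.
apply/andP; split; lra.
Qed.

(** The limit for large M of the mean number of earlier siblings of the vertex m, up to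
    an error 1 / m.-1, see sibling_rate_close. *)
Definition limit_sibling_rate m : R := ((m%:R - 2) / m%:R + same_side_limit m) / 2.

(** The term m.-1%:R^-1 accounts for k = 1, which same_side includes and sibling_rate does
    not. *)
Lemma sibling_rate_close m : (1 < m)%N ->
  `|sibling_rate m - limit_sibling_rate m| <= 7 * m%:R ^+ 2 / M%:R + m.-1%:R^-1.
Proof.
move=> m1; have := sibling_rate_riemann m1; have := same_side_close (ltnW m1).
have M0n : (0 < M)%N by rewrite double_gt0.
have /andP[r1 r2] := power_mean_bounds R m.-1 M0n; have /andP[r3 r4] := power_mean_bounds R m.-2
  M0n.
rewrite prednK in r1 r2; last by lia.
rewrite (_ : m.-2.+1 = m.-1) in r3 r4; last by lia.
have r5 := power_mean_ge0 R M m.-2.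
pose first_term : R := M%:R^-1 * \sum_(0 <= w < M) a w ^+ m.-2 * b w.
have f0 : 0 <= first_term.
  by rewrite /first_term mulr_ge0 ?invr_ge0//; apply: sumr_ge0 => w _; rewrite mulr_ge0 ?exprn_ge0.
have f1 : first_term <= power_mean R M m.-2.
  rewrite /first_term /power_mean; apply: ler_wpM2l; first by rewrite invr_ge0.
  by apply: ler_sum_nat => w /andP[_ wM]; rewrite ler_piMr ?exprn_ge0 ?b_le1.
have E : riemann_rate m = (m%:R - 2) * power_mean R M m.-1 + same_side m - first_term.
  rewrite /riemann_rate /riemann_pair -mulr_sumr exchange_big /same_side /first_term /power_mean.
  rewrite mulrCA -mulrDr -mulrBr; congr (_ * _); rewrite mulr_sumr -big_split -sumrB.
  apply: eq_big_nat => w _ /=; rewrite [X in _ = _ + X - _]big_ltn// subn1 expr1.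
  under eq_bigr do rewrite mulrDr; rewrite big_split /=.
  rewrite [X in _ + X = _](_ : _ = (m%:R - 2) * a w ^+ m.-1); last first.
    rewrite (eq_big_nat _ _ (F2 := fun=> a w ^+ m.-1)).
      by rewrite big_const_nat iter_addr addr0 -[_ *+ _]mulr_natl natrB.
    by move=> k kr; rewrite -exprD; congr (_ ^+ _); lia.
  set x := _ * _; set y := _ * _; set z := \sum_(_ <= _ < _) _; ring.
pose mM : R := m%:R / M%:R.
have m2 : 2 <= m%:R :> R by rewrite ler_nat.
have mM1 : mM <= m%:R * mM by rewrite ler_peMl ?divr_ge0//; lra.
have e0 : 0 <= M%:R^-1 :> R by rewrite invr_ge0.
have d1 : - mM <= (m%:R - 2) * (power_mean R M m.-1 - m%:R^-1).
  apply: (@le_trans _ _ ((m%:R - 2) * - M%:R^-1)).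
    by rewrite mulrN lerN2 /mM ler_wpM2r//; lra.
  by rewrite ler_wpM2l//; lra.
have d2 : (m%:R - 2) * (power_mean R M m.-1 - m%:R^-1) <= 0 by rewrite mulr_ge0_le0//; lra.
have fold (c x : R) : c * x / M%:R = c * (x / M%:R) by rewrite mulrA.
rewrite /limit_sibling_rate !fold -/mM E.
set S := same_side m; set q := m%:R * mM in mM1 *; set Z := sibling_rate m.
rewrite mulrBr in d1 d2; set V := _ * power_mean R M m.-1 in d1 d2 *;
  set t := _ * m%:R^-1 in d1 d2 *.
set i := m.-1%:R^-1 in r3 r4 *.
have fi : first_term <= i by exact: le_trans f1 r4.
have i0 : 0 <= i by rewrite /i invr_ge0.
rewrite !ler_norml => /andP[h1 h2] /andP[h3 h4]; apply/andP; split; lra.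
Qed.

Lemma sum_sibling_rate_close n :
  `|\sum_(2 <= m < n) sibling_rate m - \sum_(2 <= m < n) limit_sibling_rate m| <=
  7 * n%:R ^+ 3 / M%:R + \sum_(2 <= m < n) m.-1%:R^-1.
Proof.
rewrite -sumrB; apply: le_trans (ler_norm_sum _ _ _) _.
apply: (@le_trans _ _ (\sum_(2 <= m < n) (7 * n%:R ^+ 2 / M%:R + m.-1%:R^-1))).
  apply: ler_sum_nat => m /andP[m2 mn]; apply: le_trans (sibling_rate_close m2) _.
  rewrite lerD2r ler_wpM2r ?invr_ge0// ler_wpM2l// ler_pXn2r ?nnegrE ?ler0n//.
  by rewrite ler_nat ltnW.
rewrite big_split lerD2r /= big_const_nat iter_addr addr0 -[_ *+ _]mulr_natr.
rewrite (exprSr _ 2) (_ : 7 * (n%:R ^+ 2 * n%:R) / M%:R = 7 * n%:R ^+ 2 / M%:R * n%:R);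
  last by ring.
by rewrite ler_wpM2l ?ler_nat ?leq_subr// divr_ge0// mulr_ge0// exprn_ge0.
Qed.

(** The pairs with k = 1, to which mean_both_attachE does not apply, are at most as many
    as the children of the vertex 0. *)
Lemma mean_sibling_pairs_close n :
  `|mean (words (fun=> enum 'I_N) n)
      (fun s => (sibling_pairs predT (nth 0 s) n)%:R : R) -
    \sum_(2 <= m < n) limit_sibling_rate m|
  <= (max_degree M)%:R + 7 * n%:R ^+ 3 / M%:R + \sum_(2 <= m < n) m.-1%:R^-1.
Proof.
pose W := words (fun=> enum 'I_N) n.
pose c (s : seq 'I_N) v k m := (child predT (nth 0 s) v k && child predT (nth 0 s) v m : nat).
(* late counts the pairs with 2 <= k; those with k = 1 have the parent 0. *)
pose late s := (\sum_(2 <= m < n) \sum_(2 <= k < m) \sum_(0 <= v < k) c s v k m)%N.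
have lateE : mean W (fun s => (late s)%:R : R) = \sum_(2 <= m < n) sibling_rate m.
  have -> : mean W (fun s => (late s)%:R : R) = mean W (fun s =>
     \sum_(2 <= m < n) \sum_(2 <= k < m) \sum_(0 <= v < k) (c s v k m)%:R).
    apply: eq_mean => s; rewrite natr_sum; apply: eq_bigr => m _.
    by rewrite natr_sum; apply: eq_bigr => k _; rewrite natr_sum.
  rewrite mean_sum; apply: eq_big_nat => m /andP[_ mn]; rewrite mean_sum.
  apply: eq_big_nat => k /andP[k2 km]; rewrite mean_sum.
  rewrite (eq_big_nat _ _ (F2 := fun=> pair_rate m k)).
    by rewrite big_const_nat subn0 iter_addr addr0 -[_ *+ _]mulr_natl.
  move=> v /andP[_ vk]; exact: mean_both_attachE.
have close s : (late s <= sibling_pairs predT (nth 0%R s) n <= late s + max_degree M)%N.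
  have -> : sibling_pairs predT (nth 0%R s) n = (\sum_(0 <= m < n) \sum_(0 <= k < m) \sum_(0 <= v
    < k) c s v k m)%N.
    rewrite /sibling_pairs exchange_big /=.
    transitivity (\sum_(0 <= k < n) \sum_(0 <= m < n) (\sum_(0 <= v < n) [&& k < m, child predT
      (nth 0%R s) v k & child predT (nth 0%R s) v m]))%N.
      by apply: eq_bigr => k _; rewrite exchange_big.
    rewrite exchange_big; apply: eq_big_nat => m /andP[_ mn] /=.
    rewrite (@big_cat_nat _ _ _ m)//=; last by lia.
    rewrite [X in (_ + X)%N]big_nat [X in (_ + X)%N]big1 ?addn0; last first.
      by move=> k /andP[mk _]; rewrite big1// => v _; rewrite ltnNge mk.
    apply: eq_big_nat => k /andP[_ km]; rewrite (@big_cat_nat _ _ _ k)//=; last by lia.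
    rewrite [X in (_ + X)%N]big_nat [X in (_ + X)%N]big1 ?addn0; last first.
      move=> v /andP[kv _]; rewrite km /=; case: childP => // -[_ _]; lia.
    by apply: eq_big_nat => v _; rewrite km.
  have inner m : (1 < m)%N -> (\sum_(0 <= k < m) \sum_(0 <= v < k) c s v k m =
      \sum_(2 <= k < m) \sum_(0 <= v < k) c s v k m + c s 0%N 1%N m)%N.
    move=> m2; rewrite big_ltn; last by lia.
    by rewrite big_geq// add0n big_ltn// big_nat1 addnC.
  have [n2|n2] := leqP n 1.
    rewrite /late big_geq; last by lia.
    have [n0|n1] := leqP n 0; first by rewrite big_geq.
    by rewrite (_ : n = 1)%N ?big_nat1 ?big_geq//; lia.
  rewrite big_ltn; last by lia.
  rewrite big_geq// add0n big_ltn// big_nat1 big_geq// add0n.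
  rewrite (eq_big_nat _ _ (F2 := fun m => (\sum_(2 <= k < m) \sum_(0 <= v < k) c s v k m + c s 0 1
    m)%N)); last first.
    by move=> m /andP[m2 _]; exact: inner.
  rewrite big_split /= -/(late s) leq_addr leq_add2l /=.
  apply: leq_trans (degree_le predT (nth 0%R s) n 0); rewrite [leqRHS](@big_cat_nat _ _ _ 2)//=.
  apply: leq_trans (leq_addl _ _); apply: leq_sum => m _; rewrite /c.
  by case: (child _ _ 0 1)%N.
have W0 : (0 < size W)%N by rewrite size_words prodn_gt0// => i; rewrite size_enum_ord.
have := sum_sibling_rate_close n; rewrite -lateE.
set S := mean W _; set L := \sum_(_ <= _ < _) limit_sibling_rate _; set D := (max_degree M)%:R.
have l1 : S <= mean W (fun s => (sibling_pairs predT (nth 0 s) n)%:R : R).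
  by apply: ler_mean => s; rewrite ler_nat; case/andP: (close s).
have l2 : mean W (fun s => (sibling_pairs predT (nth 0 s) n)%:R : R) <= S + D.
  rewrite -(mean_cst D W0) /S -meanD; apply: ler_mean => s; rewrite -natrD ler_nat.
  by case/andP: (close s).
rewrite !ler_norml -/W => /andP[h1 h2]; apply/andP; split; first by have : 0 <= D by []; lra.
lra.
Qed.

End MeanAsymptotics.

(** * Near ties *)

Lemma mean_exchange (R : realFieldType) (T U : Type) (r : seq T) (t : seq U) (g : T -> U -> R) :
  mean r (fun x => mean t (g x)) = mean t (fun y => mean r (g ^~ y)).
Proof. by rewrite /mean -!mulr_sumr exchange_big mulrCA. Qed.

(** The letter j can be resampled independently of the others. *)
Lemma mean_words_set_nth (R : realFieldType) (T : eqType) (S : nat -> seq T) x0 n j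
    (f : seq T -> R) :
  (j < n)%N -> (forall i, 0 < size (S i))%N ->
  mean (words S n) f = mean (words S n) (fun s => mean (S j) (fun y => f (set_nth x0 s j y))).
Proof.
move=> jn S0; elim: n f jn => // n IH f; rewrite ltnS leq_eqVlt => /orP[/eqP jn|jn].
  rewrite !mean_words_recr; apply: eq_mean_in => s /(wordsP S x0)[ss _].
  rewrite -[LHS](mean_cst _ (S0 n)); apply: eq_mean => a; rewrite jn; apply: eq_mean => y.
  congr f; apply: (@eq_from_nth _ x0) => [|i _].
    by rewrite size_set_nth !size_rcons ss; lia.
  rewrite nth_set_nth /= !nth_rcons ss; case: (eqVneq i n) => [->|_]; first by rewrite ltnn.
  by case: ltnP.
rewrite !mean_words_recr IH//; apply: eq_mean_in => s /(wordsP S x0)[ss _].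
rewrite mean_exchange; apply: eq_mean => a; apply: eq_mean => y; congr f.
apply: (@eq_from_nth _ x0) => [|i _].
  by rewrite size_rcons !size_set_nth size_rcons ss; lia.
rewrite nth_rcons size_set_nth ss !nth_set_nth /= nth_rcons ss.
by rewrite (maxn_idPr jn) ; case: eqP => [->|//]; rewrite jn.
Qed.

Section NearTies.
Variable M : nat.
Local Notation N := (M.*2).+1.
Local Notation T := 'I_(M.*2).+1.

(** The distances from i and from j to k differ by at most one unit, which is the precision
    that is lost when points are replaced by cells. For i = k this means that j and k are
    in equal or adjacent cells. *)
Definition near_tie (x : nat -> T) i j k : bool :=
  (cnorm (x i - x k) <= (cnorm (x j - x k)).+1)%N &&
  (cnorm (x j - x k) <= (cnorm (x i - x k)).+1)%N.

Definition has_near_tie (x : nat -> T) n : bool :=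
  has (fun i => has (fun j => has (fun k => [&& j != i, j != k & near_tie x i j k])
    (iota 0 n)) (iota 0 n)) (iota 0 n).

Lemma card_cnorm r : (\sum_(y : T) (cnorm y == r) <= 2)%N.
Proof.
apply: (@leq_trans (\sum_(y : T) ((y == inord r) + (y == inord (N - r))))).
  apply: leq_sum => y _; rewrite -!val_eqE /= /cnorm.
  have yN := ltn_ord y; case: (leqP y (N - y)) => h.
    by case: eqP => // <-; rewrite inordK// eqxx.
  case: eqP => // <-.
  by rewrite subKn ?(ltnW yN)// (inordK yN) eqxx addn1.
rewrite big_split /=; have one (b : T) : (\sum_(y : T) (y == b) = 1)%N.
  by rewrite (bigD1 b)//= eqxx big1 ?addn0// => y /negPf->.
by rewrite !one.
Qed.

Lemma card_near_tie (a b : T) :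
  (\sum_(y : T) ((cnorm (a - b) <= (cnorm (y - b)).+1) && (cnorm (y - b) <= (cnorm (a - b)).+1))
    <= 6)%N.
Proof.
rewrite (reindex_inj (addIr b)) /=; set r := cnorm (a - b).
apply: (@leq_trans (\sum_(y : T) ((cnorm y == r.-1) + ((cnorm y == r) + (cnorm y == r.+1))))).
  apply: leq_sum => y _; rewrite addrK; move: (cnorm y) => c; lia.
by rewrite !big_split -[6%N]/(2 + (2 + 2))%N !leq_add ?card_cnorm.
Qed.

(** Once x i and x k are fixed, at most 6 of the N positions of x j create a near tie. *)
Lemma mean_near_tie (R : realFieldType) n :
  mean (words (fun=> enum T) n) (fun s => (has_near_tie (nth 0 s) n)%:R : R)
  <= 6 * n%:R ^+ 3 / N%:R.
Proof.
set W := words _ n.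
have S0 (i : nat) : (0 < size (enum T))%N by rewrite size_enum_ord.
have W0 : (0 < size W)%N by rewrite size_words prodn_gt0// => i; exact: S0.
apply: (@le_trans _ _ (mean W (fun s =>
   \sum_(i <- iota 0 n) \sum_(j <- iota 0 n) \sum_(k <- iota 0 n)
     [&& j != i, j != k & near_tie (nth 0 s) i j k]%:R))).
  apply: ler_mean => s; rewrite /has_near_tie.
  have hs (p : pred nat) (g : nat -> R) r : (forall i, (p i)%:R <= g i) ->
      (has p r)%:R <= \sum_(i <- r) g i.
    move=> pg; elim: r => [|i r IH]; first by rewrite big_nil.
    rewrite big_cons /=; apply: le_trans (lerD (pg i) IH).
    by case: (p i); case: (has p r); rewrite /= ?addr0 ?add0r// ler_wpDr.
  by do 3 (apply: (hs) => ?).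
rewrite mean_sum.
have e : 6 * n%:R ^+ 3 / N%:R = \sum_(i <- iota 0 n) \sum_(j <- iota 0 n) \sum_(k <- iota 0 n) (6
  / N%:R) :> R.
  have h (c : R) : \sum_(i <- iota 0 n) c = n%:R * c.
    by rewrite big_const_seq count_predT size_iota iter_addr addr0 mulr_natl.
  rewrite !h; ring.
rewrite e [leLHS]big_seq [leRHS]big_seq; apply: ler_sum => i; rewrite mem_iota add0n => /= iN.
rewrite mean_sum [leLHS]big_seq [leRHS]big_seq; apply: ler_sum => j;
  rewrite mem_iota add0n => /= jN.
rewrite mean_sum; apply: ler_sum => k _.
case: (eqVneq j i) => [ji|ji].
  by rewrite mean_cst// ?divr_ge0.
case: (eqVneq j k) => [jk|jk].
  by rewrite mean_cst// ?divr_ge0.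
rewrite (mean_words_set_nth 0 _ jN)// -[leRHS](mean_cst _ W0).
apply: ler_mean => s; rewrite /mean size_enum_ord mulrC ler_wpM2r ?invr_ge0// -natr_sum.
rewrite ler_nat big_enum /=; apply: leq_trans (card_near_tie (nth 0 s i) (nth 0 s k)).
apply: leq_sum => y _; rewrite /near_tie !nth_set_nth /= eqxx.
by rewrite eq_sym (negPf ji) eq_sym (negPf jk).
Qed.

(** All that is known about actual distances is that they are ordered like the cyclic ones
    when these differ by at least 2. Without near ties this orders all distances to k,
    so that the nearest point in either sense is the same. *)
Lemma child_nearest (x : nat -> T) (close : nat -> nat -> nat -> bool) (parent : nat -> nat) n :
  ~~ has_near_tie x n ->
  (forall i j k, (i < n)%N -> (j < n)%N -> (k < n)%N ->
     (cnorm (x i - x k) + 2 <= cnorm (x j - x k))%N -> ~~ close j i k) ->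
  (forall k, (0 < k < n)%N -> (parent k < k)%N /\
     forall j, (j < k)%N -> close (parent k) j k) ->
  forall v k, (0 < k < n)%N -> child predT x v k = (v == parent k).
Proof.
move=> nt cl pa v k /[dup] kn /pa[pk hp].
have sep i j l : (i < n)%N -> (j < n)%N -> (l < n)%N -> j != i -> j != l -> ~~ near_tie x i j l.
  move=> iN jN lN ji jl; apply: contra nt => h.
  apply/hasP; exists i; first by rewrite mem_iota.
  apply/hasP; exists j; first by rewrite mem_iota.
  by apply/hasP; exists l; [rewrite mem_iota|rewrite ji jl].
have K : child predT x (parent k) k.
  apply/childP; split => //.
    have : ~~ near_tie x k (parent k) k by apply: sep; lia.
    by rewrite /near_tie subrr cnorm0 -subr_eq0 -cnorm_gt0; case: (cnorm _).
  move=> j jk _ jp.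
  have : ~~ near_tie x j (parent k) k by apply: sep; lia.
  have : ~~ (cnorm (x j - x k) + 2 <= cnorm (x (parent k) - x k))%N.
    apply/negP => h; have /negP := cl j (parent k) k ltac:(lia) ltac:(lia) ltac:(lia) h.
    by apply; exact: hp.
  by rewrite /near_tie; move: (cnorm (x j - x k)) (cnorm (x (parent k) - x k)) => c c'; lia.
by apply/idP/eqP => [h|->//]; exact: child_parent_uniq h K.
Qed.

Lemma pairs_sibling_pairs (x : nat -> T) (parent : nat -> nat) n :
  (forall v k, (0 < k < n)%N -> child predT x v k = (v == parent k)) ->
  (forall k, (0 < k < n)%N -> (parent k < k)%N) ->
  pairs (map parent (iota 1 n.-1)) = sibling_pairs predT x n.
Proof.
move=> cE pk; rewrite (pairs_nth 0%N) size_map size_iota.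
case: n cE pk => [|n] cE pk; first by rewrite big_ord0 /sibling_pairs big_geq.
rewrite /sibling_pairs exchange_big /=.
transitivity (\sum_(0 <= k < n.+1) \sum_(0 <= m < n.+1) [&& 0 < k, k < m & parent k == parent
  m])%N; last first.
  apply: eq_big_nat => k kn; rewrite exchange_big; apply: eq_big_nat => m mn /=.
  case: (posnP k) => [->|k0] /=.
    by rewrite big1// => v _; case: (childP predT x v 0) => [[]|]//; rewrite ?andbF.
  case: ltnP => km /=; last by rewrite big1.
  have kr : (0 < k < n.+1)%N by lia.
  have mr : (0 < m < n.+1)%N by lia.
  under eq_bigr do rewrite !cE//.
  rewrite (bigD1_seq (parent k)) ?iota_uniq//=; last first.
    by rewrite mem_index_iota; have := pk _ kr; lia.
  by rewrite eqxx big1 ?addn0// => v /negPf->.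
rewrite exchange_big /= [RHS]big_ltn// [X in _ = (X + _)%N]big1 ?add0n; last first.
  by move=> k _; rewrite ltn0 andbF.
rewrite big_add1 big_mkord; apply: eq_bigr => j _.
rewrite [RHS]big_ltn// add0n big_add1 /=.
rewrite -(big_mkord xpredT (fun i => (nth 0%N (map parent (iota 1 n)) i == nth 0%N (map parent
  (iota 1 n)) j : nat))).
rewrite [RHS](@big_cat_nat _ _ _ j)//=; last by rewrite ltnW.
rewrite [X in _ = (_ + X)%N]big_nat [X in _ = (_ + X)%N]big1 ?addn0; last first.
  by move=> i /andP[ij _]; rewrite ltnS ltnNge ij.
apply: eq_big_nat => i /andP[_ ij]; have jn := ltn_ord j; have iN := ltn_trans ij jn.
by rewrite !(nth_map 0%N) ?size_iota// !nth_iota// !add1n ltnS ij.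
Qed.

End NearTies.

(** * Almost sure convergence from deviations along powers *)

Section Subsequence.
Variable R : realType.

Lemma cvg_succ_ratio_pow p : ((k.+2%:R / k.+1%:R : R) ^+ p) @[k --> \oo] --> (1 : R).
Proof.
have h : (k.+2%:R / k.+1%:R : R) @[k --> \oo] --> (1 : R).
  have -> : (fun k => k.+2%:R / k.+1%:R : R) = (fun k => 1 + @harmonic R k).
    apply/funext => k; rewrite /harmonic /= -[k.+2%:R]natr1 mulrDl mulfV ?pnatr_eq0//.
    by rewrite mul1r.
  by rewrite -[X in _ --> X]addr0; apply: cvgD; [exact: cvg_cst|exact: cvg_harmonic].
have := @continuous_cvg _ _ _ _ _ _ (fun x : R => x ^+ p) _ (@exprn_continuous R p 1) h.
by rewrite /= expr1n => h1; exact: h1.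
Qed.

(** By monotonicity, between (r n).+1 ^ p and (r n).+2 ^ p the ratio changes by at most the
    factor q (r n), which tends to 1. *)
Lemma cvg_ratio_of_subpower (F : nat -> R) p (L : R) : (0 < p)%N ->
  {homo F : m n / (m <= n)%N >-> m <= n} -> (forall n, 0 <= F n) ->
  F (k ^ p)%N / (k ^ p)%:R @[k --> \oo] --> L ->
  F n / n%:R @[n --> \oo] --> L.
Proof.
move=> p0 Fmono F0 FL.
have : forall n, exists k, (k.+1 ^ p <= n.+1 < k.+2 ^ p)%N.
  move=> n; have ex : exists k, (k.+1 ^ p <= n.+1)%N by exists 0%N; rewrite exp1n.
  have bd k : (k.+1 ^ p <= n.+1)%N -> (k <= n)%N.
    by move=> kn; rewrite -ltnS (leq_trans _ kn)// -{1}(expn1 k.+1) leq_pexp2l.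
  exists (ex_maxn ex bd); case: ex_maxnP => k -> /= kmax; rewrite ltnNge; apply/negP => h.
  by have := kmax _ h; rewrite ltnn.
move=> /choice[r rP].
have r_oo : r n @[n --> \oo] --> \oo.
  apply/cvgnyPge => A; near=> n.
  have nA : (A.+2 ^ p <= n)%N by near: n; exact: nbhs_infty_ge.
  have /andP[_ h] := rP n; rewrite leqNgt; apply/negP => rA.
  have : (n.+1 < A.+2 ^ p)%N.
    by apply: leq_trans h _; rewrite leq_exp2r//; lia.
  by lia.
rewrite -cvg_shiftS.
pose G k := F (k ^ p)%N / (k ^ p)%:R.
pose q k : R := (k.+2%:R / k.+1%:R) ^+ p.
have qE k : q k = (k.+2 ^ p)%:R / (k.+1 ^ p)%:R by rewrite /q expr_div_n !natrX.
have q_gt0 k : 0 < q k by rewrite /q exprn_gt0// divr_gt0.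
have G1 : G (r n).+1 @[n --> \oo] --> L.
  have /cvg_comp : (r n).+1 @[n --> \oo] --> \oo.
    apply/cvgnyPge => A; have /cvgnyPge/(_ A) := r_oo.
    by apply: filterS => n; exact: leqW.
  exact.
have G2 : G (r n).+2 @[n --> \oo] --> L.
  have /cvg_comp : (r n).+2 @[n --> \oo] --> \oo.
    apply/cvgnyPge => A; have /cvgnyPge/(_ A) := r_oo.
    by apply: filterS => n An; lia.
  exact.
have q1 : q (r n) @[n --> \oo] --> (1 : R).
  exact: (cvg_comp _ _ r_oo (@cvg_succ_ratio_pow p)).
apply: (@squeeze_cvgr _ _ _ _ (fun n => G (r n).+1 / q (r n)) (fun n => G (r n).+2 * q (r n))).
- apply: nearW => n; have /andP[h1 h2] := rP n.
  have e1 : 0 < ((r n).+1 ^ p)%:R :> R by rewrite ltr0n expn_gt0.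
  have e2 : 0 < ((r n).+2 ^ p)%:R :> R by rewrite ltr0n expn_gt0.
  have n0 : 0 < n.+1%:R :> R by [].
  rewrite qE /G; apply/andP; split.
    rewrite invf_div mulf_div [X in _ / X]mulrC -mulf_div mulfV ?gt_eqF// mulr1.
    by apply: ler_pM; rewrite ?invr_ge0 ?F0 ?ler0n ?Fmono// lef_pV2 ?posrE// ler_nat ltnW.
  rewrite mulf_div [X in X / _]mulrC [X in X / _]mulrC -mulrA invfM mulrA -mulrA.
  rewrite [X in _ <= _ * X](_ : _ = ((r n).+1 ^ p)%:R^-1); last by field; rewrite !gt_eqF.
  apply: ler_pM; rewrite ?invr_ge0 ?F0 ?ler0n//; first by apply: Fmono; exact: ltnW.
  by rewrite lef_pV2 ?posrE// ler_nat.
- rewrite -[X in _ --> X]divr1; apply: cvgM => //; apply: cvgV => //; exact: oner_neq0.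
- by rewrite -[X in _ --> X]mulr1; apply: cvgM.
Unshelve. all: by end_near.
Qed.

End Subsequence.

Section StrongLaw.
Context (d : measure_display) (Omega : measurableType d) (R : realType).
Variable P : probability Omega R.

Lemma sum_inv_sqr_le n : \sum_(0 <= k < n) (k.+1%:R ^+ 2)^-1 <= 2 :> R.
Proof.
case: n => [|n]; first by rewrite big_geq.
suff : \sum_(0 <= k < n.+1) (k.+1%:R ^+ 2)^-1 <= 2 - n.+1%:R^-1 :> R.
  by move=> h; apply: le_trans h _; rewrite gerBl invr_ge0.
elim: n => [|n IH]; first by rewrite big_nat1 expr1n invr1; lra.
rewrite big_nat_recr//=; apply: le_trans (lerD IH (lexx _)) _.
have n0 : 0 < n.+1%:R :> R by [].
have e : n.+2%:R = n.+1%:R + 1 :> R by rewrite natr1.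
rewrite e; set x : R := n.+1%:R in n0 *.
have -> : 2 - (x + 1)^-1 = 2 - x^-1 + (x * (x + 1))^-1.
  by field; apply/andP; split; rewrite gt_eqF//; lra.
rewrite lerD2l lef_pV2 ?posrE ?exprn_gt0 ?mulr_gt0//; lra.
Qed.

(** Borel-Cantelli along the powers k ^ p, for each deviation e = j.+1%:R^-1, followed by
    cvg_ratio_of_subpower. *)
Lemma ae_cvg_of_summable_deviations (F : nat -> Omega -> R) (mu : nat -> R) p (L : R) :
  (0 < p)%N ->
  (forall w, {homo F ^~ w : m n / (m <= n)%N >-> m <= n}) -> (forall n w, 0 <= F n w) ->
  mu k / (k ^ p)%:R @[k --> \oo] --> L ->
  (forall e, 0 < e -> exists C, forall k, (0 < k)%N -> exists E : set Omega,
     [/\ measurable E, (P E <= (C / k%:R ^+ 2)%:E)%E &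
       forall w, e * (k ^ p)%:R <= `|F (k ^ p)%N w - mu k| -> E w]) ->
  {ae P, forall w, F n w / n%:R @[n --> \oo] --> L}.
Proof.
move=> p0 Fmono F0 muL dev.
pose e (j : nat) : R := j.+1%:R^-1.
have e_gt0 j : 0 < e j by rewrite invr_gt0.
have good j : {ae P, forall w, \forall k \near \oo,
    `|F (k ^ p)%N w - mu k| < e j * (k ^ p)%:R}.
  have [C hC] := dev _ (e_gt0 j).
  have /choice[E hE] : forall k, exists E : set Omega,
     [/\ measurable E, (P E <= (C / k.+1%:R ^+ 2)%:E)%E &
       forall w, e j * (k.+1 ^ p)%:R <= `|F (k.+1 ^ p)%N w - mu k.+1| -> E w].
    by move=> k; exact: hC.
  have mE k : measurable (E k) by case: (hE k).
  have mL : measurable (lim_sup_set E).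
    by apply: bigcapT_measurable => k; apply: bigcup_measurable.
  have L0 : P (lim_sup_set E) = 0.
    apply: lim_sup_set_cvg0 => //.
    have C0 : 0 <= C.
      have [_ h _] := hE 0%N.
      have := le_trans (measure_ge0 P (E 0%N)) h; rewrite expr1n divr1 lee_fin; exact.
    apply: (@le_lt_trans _ _ (C * 2)%:E); last exact: ltry.
    apply: lime_le; first by apply: is_cvg_nneseries => k _ _; exact: measure_ge0.
    apply: nearW => n.
    apply: (@le_trans _ _ (\sum_(0 <= k < n) (C / k.+1%:R ^+ 2)%:E)%E).
      by apply: lee_sum => k _; case: (hE k).
    by rewrite sumEFin lee_fin -mulr_sumr ler_wpM2l// sum_inv_sqr_le.
  apply: negligibleS; last by apply/negligibleP; [exact: mL|exact: L0].
  move=> w /= nw; apply: contrapT => nL; apply: nw.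
  have [n hn] : exists n, forall k, (n <= k)%N -> ~ E k w.
    apply: contrapT => /forallNP h; apply: nL => n _.
    have /existsNP[k /not_implyP[nk /contrapT Ekw]] := h n.
    by exists k.
  exists n.+1 => // -[//|k]/= nk; rewrite ltNge; apply/negP => dk.
  by apply: (hn k) => //; have [_ _] := hE k; exact.
have := ae_foralln good; apply: filterS => w hw.
apply: (cvg_ratio_of_subpower p0 (Fmono w) (F0 ^~ w)).
have d0 : (F (k ^ p)%N w - mu k) / (k ^ p)%:R @[k --> \oo] --> (0 : R).
  apply/cvgrPdist_lt => eps eps0.
  have [j jeps] : exists j, e j < eps.
    have /cvgrPdist_lt/(_ _ eps0)[j _ hj] := @cvg_harmonic R.
    exists j; have := hj j (leqnn _); rewrite /= sub0r normrN ger0_norm;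
      last exact: (ltW (e_gt0 j)).
    exact.
  near=> k; rewrite sub0r normrN.
  have k0 : (0 < k)%N by near: k; exact: nbhs_infty_gt.
  have kp : 0 < (k ^ p)%:R :> R by rewrite ltr0n expn_gt0 k0.
  rewrite normrM normfV [X in _ / X]gtr0_norm// ltr_pdivrMr//.
  apply: lt_trans (_ : e j * (k ^ p)%:R < _); last by rewrite ltr_pM2r.
  by near: k; exact: hw.
rewrite -[L]add0r; apply: cvg_trans (cvgD d0 muL); apply: near_eq_cvg; apply: nearW => k /=.
by rewrite -mulrDl subrK.
Unshelve. all: by end_near.
Qed.

Lemma measure_union_le (I : eqType) (r : seq I) (D : I -> set Omega) (g : I -> R) :
  {in r, forall i, measurable (D i)} -> {in r, forall i, (P (D i) <= (g i)%:E)%E} ->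
  exists E : set Omega, [/\ measurable E, (P E <= (\sum_(i <- r) g i)%:E)%E &
    forall i w, i \in r -> D i w -> E w].
Proof.
elim: r => [_ _|i r IH mD gD].
  by exists set0; split => //; rewrite measure0 big_nil.
have ri j : j \in r -> j \in i :: r by rewrite inE => ->; rewrite orbT.
have [|| E [mE PE DE]] := IH.
- by move=> j /ri; exact: mD.
- by move=> j /ri; exact: gD.
have mDi : measurable (D i) by apply: mD; rewrite mem_head.
exists (D i `|` E); split; first exact: measurableU.
  rewrite big_cons EFinD; apply: le_trans (measureU2 P mDi mE) _.
  by apply: leeD => //; apply: gD; rewrite mem_head.
move=> j w; rewrite inE => /orP[/eqP->|jr Djw]; first by left.
by right; exact: DE jr Djw.
Qed.

(** The events C s stand for the realization of the word s: if they are at most as likely as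
    under the uniform law on words, then probabilities are bounded by means over words. *)
Lemma words_event_le (T : eqType) (S : nat -> seq T) n (C : seq T -> set Omega)
    (b : pred (seq T)) :
  {in words S n, forall s, measurable (C s)} ->
  {in words S n, forall s, (P (C s) <= ((size (words S n))%:R^-1)%:E)%E} ->
  exists E : set Omega, [/\ measurable E,
    (P E <= (mean (words S n) (fun s => (b s)%:R))%:E)%E &
    forall s w, s \in words S n -> b s -> C s w -> E w].
Proof.
move=> mC PC; set W := words S n in mC PC *.
have fW s : s \in [seq s <- W | b s] -> s \in W by rewrite mem_filter => /andP[].
have [s /fW|s /fW|E [mE PE CE]] := @measure_union_le _ [seq s <- W | b s] C (fun=> (size W)%:R^-1).
- exact: mC.
- exact: PC.
exists E; split => // [|s w sW bs]; last by apply: CE; rewrite mem_filter bs.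
apply: le_trans PE _; rewrite lee_fin /mean mulr_sumr big_filter big_mkcond.
by apply: ler_sum => s _; case: (b s); rewrite ?mulr1 ?mulr0.
Qed.

End StrongLaw.

(** * Arcs of the circle *)

Section Circle.
Variable R : realType.
Implicit Types (s t u : R) (x y : R * R).

Definition circle_point t : R * R := (cos (2 * pi * t), sin (2 * pi * t)).

Lemma cos_turnD1 t : cos (2 * pi * (t + 1)) = cos (2 * pi * t).
Proof. by rewrite mulrDr mulr1 mulr_natl cosD2pi. Qed.

Lemma sin_turnD1 t : sin (2 * pi * (t + 1)) = sin (2 * pi * t).
Proof. by rewrite mulrDr mulr1 mulr_natl sinD2pi. Qed.

Lemma circle_point_surj x : circle x -> exists2 t, 0 <= t < 1 & x = circle_point t.
Proof.
case: x => a b; rewrite /circle /= => ab.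
have tpi : 0 < 2 * pi :> R by rewrite mulr_gt0 ?pi_gt0.
have a1 : -1 <= a <= 1.
  have b2 := sqr_ge0 b; have : a ^+ 2 <= 1 by lra.
  rewrite -[1 in X in X -> _](expr1n _ 2) -ler_norml.
  by rewrite -[a ^+ 2]real_normK ?num_real// ler_sqr ?nnegrE.
have ca : cos (acos a) = a by rewrite acosK// in_itv.
have sa : sin (acos a) = `|b|.
  by rewrite sin_acos// -ab addrAC subrr add0r sqrtr_sqr.
have th0 := acos_ge0 a1; have thpi := acos_lepi a1.
have [b0|b0] := leP 0 b.
  exists (acos a / (2 * pi)).
    rewrite divr_ge0// ?(ltW tpi)//= ltr_pdivrMr// mul1r.
    by apply: le_lt_trans thpi _; rewrite mulr_natl mulr2n ltrDl pi_gt0.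
  by rewrite /circle_point mulrC divfK ?gt_eqF// ca sa ger0_norm.
have th_gt0 : 0 < acos a.
  rewrite lt_neqAle th0 andbT; apply/eqP => th; move: sa.
  by rewrite -th sin0 => /eqP; rewrite eq_sym normr_eq0 lt_eqF.
exists (1 - acos a / (2 * pi)).
  rewrite subr_ge0 ler_pdivrMr// mul1r gtrBl divr_gt0// andbT.
  by apply: le_trans thpi _; rewrite mulr_natl mulr2n lerDl pi_ge0.
rewrite /circle_point addrC cos_turnD1 sin_turnD1 mulrN [2 * pi * _]mulrC divfK ?gt_eqF//.
by rewrite cosN sinN ca sa ltr0_norm// opprK.
Qed.

Lemma euclid_dist_circle s t :
  euclid_dist (circle_point s) (circle_point t) = Num.sqrt (2 - 2 * cos (2 * pi * (s - t))).
Proof.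
rewrite /euclid_dist /=; congr Num.sqrt; rewrite mulrBr cosB.
have h1 := cos2Dsin2 (2 * pi * s); have h2 := cos2Dsin2 (2 * pi * t).
set a := cos _ in h1 *; set b := sin _ in h1 *; set c := cos _ in h2 *; set d := sin _ in h2 *.
clearbody a b c d; lra.
Qed.

(** For `|u| <= 1 this is the distance of u to the integers, that is, the length of the
    shorter of the two arcs of angle u, in turns. *)
Definition turn_norm u := Num.min `|u| (1 - `|u|).

Lemma cos_turn_norm u : cos (2 * pi * turn_norm u) = cos (2 * pi * u).
Proof.
have -> : cos (2 * pi * u) = cos (2 * pi * `|u|).
  by rewrite -cos_norm normrM ger0_norm// mulr_ge0// pi_ge0.
rewrite /turn_norm; case: (leP `|u| (1 - `|u|)) => // _.
by rewrite addrC cos_turnD1 mulrN cosN.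
Qed.

Lemma turn_norm_bounds u : `|u| <= 1 -> 0 <= turn_norm u <= 2^-1.
Proof.
move=> u1; have := normr_ge0 u; rewrite /turn_norm; case: (leP `|u| (1 - `|u|)) => h u0;
  apply/andP; split; lra.
Qed.

Lemma turn_norm_lip u v : `|turn_norm u - turn_norm v| <= `|u - v|.
Proof.
have h1 := ler_dist_dist u v; apply: le_trans h1.
rewrite /turn_norm; set a := `|u|; set b := `|v|.
have := ler_norm (a - b); have := ler_norm (- (a - b)); rewrite normrN.
move: `|a - b| => D d1 d2; rewrite ler_norml.
by case: (leP a (1 - a)) => h; case: (leP b (1 - b)) => h'; apply/andP; split; lra.
Qed.

(** A chord increases with its arc, because cos decreases on [0, pi]. *)
Lemma euclid_dist_lt s s' t : `|s - t| <= 1 -> `|s' - t| <= 1 ->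
  turn_norm (s - t) < turn_norm (s' - t) ->
  euclid_dist (circle_point s) (circle_point t) <
  euclid_dist (circle_point s') (circle_point t).
Proof.
move=> /turn_norm_bounds/andP[a0 a1] /turn_norm_bounds/andP[b0 b1] ab.
have pi0 : 0 < pi :> R := pi_gt0 R.
have h : cos (2 * pi * (s' - t)) < cos (2 * pi * (s - t)).
  rewrite -[ltLHS]cos_turn_norm -[ltRHS]cos_turn_norm ltr_cos ?in_itv /=.
  - by rewrite ltr_pM2l// mulr_gt0.
  - by rewrite !mulr_ge0 ?(ltW pi0)//=; nra.
  - by rewrite !mulr_ge0 ?(ltW pi0)//=; nra.
rewrite !euclid_dist_circle ltr_sqrt; first by lra.
by have := cos_le1 (2 * pi * (s - t)); lra.
Qed.

End Circle.

Section Cells.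
Variables (R : realType) (M : nat).
Hypothesis M0 : (0 < M)%N.
Local Notation N := (M.*2).+1.
Local Notation T := 'I_(M.*2).+1.

Definition cross (x y : R * R) : R := x.1 * y.2 - x.2 * y.1.

(** For M > 0, the arc of parameters t with c / N <= t < c.+1 / N (circle_arcP). It is
    given by the orientation of x with respect to the two end points, so as to be
    evidently Borel. *)
Definition circle_arc (c : T) : set (R * R) :=
  [set x | 0 <= cross (circle_point (c%:R / N%:R)) x /\
           cross (circle_point (c.+1%:R / N%:R)) x < 0].

Lemma cross_circle (s t : R) : cross (circle_point s) (circle_point t) = sin (2 * pi * (t - s)).
Proof. by rewrite /cross /circle_point /= mulrBr sinB; ring. Qed.

Let N0 : 0 < N%:R :> R. Proof. by rewrite ltr0n. Qed.

Lemma circle_arcP (c : T) (t : R) : 0 <= t < 1 ->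
  circle_arc c (circle_point t) <-> c%:R / N%:R <= t < c.+1%:R / N%:R.
Proof.
move=> /andP[t0 t1]; rewrite /circle_arc /= !cross_circle.
have pi0 : 0 < pi :> R := pi_gt0 R.
have sgt (u : R) : 0 < u < 2^-1 -> 0 < sin (2 * pi * u).
  move=> /andP[u0 u1]; apply: sin_gt0_pi; apply/andP; split; first by apply: mulr_gt0 => //;
    exact: mulr_gt0.
  have : 0 < pi * (2^-1 - u) by apply: mulr_gt0; [exact: pi_gt0|lra].
  lra.
have sge (u : R) : 0 <= u <= 2^-1 -> 0 <= sin (2 * pi * u).
  move=> /andP[u0 u1]; apply: sin_ge0_pi; apply/andP; split; first by apply: mulr_ge0 => //;
    apply: mulr_ge0 => //; exact: ltW.
  have : 0 <= pi * (2^-1 - u) by apply: mulr_ge0; [exact: pi_ge0|lra].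
  lra.
have slt (u : R) : - 2^-1 < u < 0 -> sin (2 * pi * u) < 0.
  by move=> /andP[u0 u1]; rewrite -[u]opprK mulrN sinN oppr_lt0; apply: sgt; apply/andP; split; lra.
have c0 : 0 <= c%:R / N%:R :> R by rewrite divr_ge0.
have c1 : c.+1%:R / N%:R <= 1 :> R by rewrite ler_pdivrMr// mul1r ler_nat ltn_ord.
have cE : c.+1%:R / N%:R = c%:R / N%:R + N%:R^-1 :> R by rewrite -natr1 mulrDl mul1r.
have h0 : 0 < N%:R^-1 :> R by rewrite invr_gt0.
have h3 : N%:R^-1 <= 3^-1 :> R by rewrite lef_pV2 ?posrE// ler_nat; lia.
rewrite cE in c1 *; set a := c%:R / N%:R in c0 c1 *; set h := N%:R^-1 in h0 h3 c1 *.
split => [[s1 s2]|/andP[ta tb]]; last by split; [apply: sge|apply: slt]; apply/andP; split; lra.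
have [ta|ta] := leP a t.
  rewrite /=; have [//|tb] := ltP t (a + h).
  have [td|td] := leP (t - a) 2^-1.
    by have := sge (t - (a + h)) ltac:(apply/andP; split; lra); rewrite leNgt s2.
  by have := slt (t - a - 1) ltac:(apply/andP; split; lra); rewrite -sin_turnD1 subrK ltNge s1.
have [td|td] := ltP (- 2^-1) (t - a).
  by have := slt (t - a) ltac:(apply/andP; split; lra); rewrite ltNge s1.
by have := sge (t - (a + h) + 1) ltac:(apply/andP; split; lra); rewrite sin_turnD1 leNgt s2.
Qed.

Lemma circle_arc_cover x : circle x -> exists c : T, circle_arc c x.
Proof.
move=> /circle_point_surj[t /[dup] t01 /andP[t0 t1] ->].
have tN : 0 <= t * N%:R by rewrite mulr_ge0// ltW.
have cN : (Num.truncn (t * N%:R) < N)%N.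
  by rewrite truncn_lt_nat//= -[ltRHS]mul1r ltr_pM2r.
exists (Ordinal cN); apply/circle_arcP => //=.
have /andP[h1 h2] := truncn_itv tN.
by rewrite ler_pdivrMr// h1 ltr_pdivlMr.
Qed.

Lemma measurable_circle_arc c : measurable (circle_arc c).
Proof.
have mc x : measurable_fun setT (cross x).
  apply: measurable_funB; exact: measurable_funM.
pose b y := (0 <= cross (circle_point (c%:R / N%:R)) y) && (cross (circle_point (c.+1%:R / N%:R))
  y < 0).
have -> : circle_arc c = b @^-1` [set true].
  by apply/seteqP; split => y /=; rewrite /b; [case=> -> ->|move=> /andP].
have mb : measurable_fun setT b.
  apply: measurable_and; [exact: measurable_fun_ler|exact: measurable_fun_ltr].
by rewrite -[_ @^-1` _]setTI; apply: mb.
Qed.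

Lemma cnorm_turn_norm (c e : T) : (cnorm (c - e))%:R / N%:R = turn_norm ((c%:R - e%:R) / N%:R) :> R.
Proof.
have i0 : 0 < N%:R^-1 :> R by rewrite invr_gt0.
rewrite /turn_norm normrM (gtr0_norm i0) distrC.
have -> : `|e%:R - c%:R| = (if e <= c then c - e else e - c)%N%:R :> R.
  case: leqP => ec; first by rewrite natrB// distrC ger0_norm// subr_ge0 ler_nat.
  by rewrite natrB ?(ltnW ec)// ger0_norm// subr_ge0 ler_nat ltnW.
have eq1 (z : R) : 1 - z / N%:R = (N%:R - z) / N%:R by rewrite mulrBl divff// gt_eqF.
rewrite eq1 -minr_pMl ?invr_ge0 ?(ltW N0)//; congr (_ / _).
have hc := ltn_ord c; have he := ltn_ord e.
rewrite -natrB; last by case: ifP; lia.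
by rewrite -natr_min /cnorm val_subI; congr (_%:R); case: ifP; lia.
Qed.

(** N times the length of an arc between two points differs by less than 1 from the cyclic
    distance of their cells. *)
Lemma circle_arc_closer x y z (c e g : T) : circle x -> circle y -> circle z ->
  circle_arc c x -> circle_arc e y -> circle_arc g z ->
  (cnorm (c - g) + 2 <= cnorm (e - g))%N ->
  euclid_dist x z < euclid_dist y z.
Proof.
move=> /circle_point_surj[s s01 ->] /circle_point_surj[s' s'01 ->] /circle_point_surj[t t01 ->].
move=> /(circle_arcP _ s01) cs /(circle_arcP _ s'01) es /(circle_arcP _ t01) gt far.
apply: euclid_dist_lt; [by rewrite ler_norml; lra|by rewrite ler_norml; lra|].
have near (u : R) (k : T) : k%:R / N%:R <= u < k.+1%:R / N%:R ->
    `|turn_norm (u - t) - (cnorm (k - g))%:R / N%:R| < N%:R^-1.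
  move=> uk; rewrite cnorm_turn_norm; apply: le_lt_trans (turn_norm_lip _ _) _.
  move: gt uk; rewrite -!natr1 !mulrDl !mulNr mul1r => gt uk; rewrite ltr_norml; lra.
have := near s c cs; have := near s' e es; rewrite !ltr_norml => /andP[h1 h2] /andP[h3 h4].
have : (cnorm (c - g))%:R / N%:R + 2 * N%:R^-1 <= (cnorm (e - g))%:R / N%:R :> R.
  by rewrite -mulrDl ler_pM2r ?invr_gt0// -natrD ler_nat.
move: h1 h2 h3 h4; set A := (cnorm (c - g))%:R / _; set B := (cnorm (e - g))%:R / _;
  set h := N%:R^-1; lra.
Qed.

Lemma circle_law_circle_arc c : (circle_law (circle_arc c) <= (N%:R^-1)%:E)%E.
Proof.
rewrite /circle_law /pushforward /uniform_prob integral_uniform_pdf.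
set U := _ @^-1` _.
have mt : measurable_fun setT (fun t : R => 2 * pi * t) by exact: measurable_funM.
have mf : measurable_fun setT (@circle_point R).
  apply: measurable_fun_pair; apply: measurableT_comp => //; apply: continuous_measurable_fun.
    exact: continuous_cos.
  exact: continuous_sin.
have mU : measurable (U `&` `[0, 1]).
  apply: measurableI => //; rewrite -[U]setTI; apply: mf => //; exact: measurable_circle_arc.
rewrite (eq_integral (fun=> 1%:E)); last first.
  by move=> t; rewrite inE => -[_ /=]; rewrite in_itv/= /uniform_pdf => ->; rewrite subr0 invr1.
rewrite integral_cst//= mul1e.
apply: (@le_trans _ _ (lebesgue_measure (`[c%:R / N%:R, c.+1%:R / N%:R] `|` [set 1 : R]))).
  apply: le_measure; rewrite ?inE//; first exact: measurableU.
  move=> t [Ut /=]; rewrite in_itv/= => /andP[t0 t1].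
  have [t1'|t1'] := ltP t 1; last by right; apply/eqP; rewrite eq_le t1 t1'.
  left; rewrite /= in_itv /=; have t01 : 0 <= t < 1 by rewrite t0.
  by have /(circle_arcP _ t01)/andP[-> /ltW ->] := Ut.
have arc_le : (lebesgue_measure `[(c%:R / N%:R)%R, (c.+1%:R / N%:R)%R]%classic <= (N%:R^-1)%:E :>
  \bar R)%E.
  rewrite lebesgue_measure_itv /=; case: ifP => _; last by rewrite lee_fin invr_ge0.
  by rewrite -EFinD lee_fin -natr1 mulrDl mul1r addrAC subrr add0r.
apply: le_trans (measureU2 _ _ _) _ => //.
by rewrite [X in (_ + X)%E](_ : _ = 0%E) ?adde0//; exact: lebesgue_measure_set1.
Qed.

End Cells.

(** * Limits of the means *)

Section Limits.
Variable R : realType.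

Definition log_partial (m : nat) (x : R) : R := \sum_(0 <= i < m) x ^+ i.+1 / i.+1%:R.

Lemma is_derive_log_partial m (x : R) :
  is_derive x 1 (log_partial m) (\sum_(0 <= i < m) x ^+ i).
Proof.
elim: m => [|m IH].
  have -> : log_partial 0 = cst 0 by apply/funext => y; rewrite /log_partial big_geq.
  by rewrite big_geq//; exact: is_derive_cst.
have dX : is_derive x 1 ((id : R -> R) ^+ m.+1) ((m.+1%:R * x ^+ m) *: 1).
  exact: is_deriveX.
have := is_deriveD IH (is_deriveZ m.+1%:R^-1 dX).
rewrite big_nat_recr//= scalerA mulrA mulVf// mul1r [_ *: 1]mulr1.
congr (is_derive _ _ _ _); apply/funext => y.
by rewrite /log_partial big_nat_recr//= !fctE mulrC.
Qed.

(** By the mean value theorem on [0, 1/2], as the derivative of the remainder of the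
    logarithmic series is c ^+ m / (1 - c), at most 2 * c ^+ m. *)
Lemma ln2_log_partial m : `|ln 2 - log_partial m 2^-1| <= 2^-1 ^+ m :> R.
Proof.
pose f (x : R) := - ln (1 - x) - log_partial m x.
pose df (x : R) := (1 - x)^-1 - \sum_(0 <= i < m) x ^+ i.
have h2 : 0 < 2^-1 :> R by [].
have fE (x : R) : x < 1 -> is_derive x 1 f (df x).
  move=> x1; apply: is_deriveB; last exact: is_derive_log_partial.
  have lnd : is_derive (1 - x) 1 (@ln R) (1 - x)^-1 by apply: is_derive1_ln; rewrite subr_gt0.
  have sd : is_derive x 1 (fun y : R => 1 - y) (-1).
    by rewrite -[X in is_derive _ _ _ X]sub0r; apply: is_deriveB.
  have := @is_derive1_comp R (@ln R) (fun y => 1 - y) x _ _ lnd sd; rewrite mulrN1 => h.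
  by rewrite -[(1 - x)^-1]opprK; exact: is_deriveN.
have [||c] := @MVT R f df 0 2^-1 h2.
- by move=> x; rewrite in_itv /= => /andP[_ x1]; apply: fE; lra.
- apply: derivable_within_continuous => x; rewrite in_itv /= => /andP[_ x1].
  by have [] : is_derive x 1 f (df x) by apply: fE; lra.
rewrite in_itv /= => /andP[c0 c1].
have -> : f 0 = 0.
  rewrite /f subr0 ln1 oppr0 sub0r /log_partial big1 ?oppr0// => i _.
  by rewrite expr0n mul0r.
have -> : f 2^-1 = ln 2 - log_partial m 2^-1.
  by rewrite /f (_ : 1 - 2^-1 = 2^-1) ?lnV ?opprK ?posrE//; lra.
rewrite !subr0 => ->.
have c1' : 1 - c != 0 by rewrite gt_eqF//; lra.
have -> : df c = c ^+ m / (1 - c).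
  rewrite /df; apply: (mulfI c1'); rewrite mulrBr mulfV// mulrCA mulfV// mulr1.
  have := subrX1 c m; rewrite big_mkord => h; rewrite -[1 - c]opprB mulNr -h; ring.
have cm : 0 <= c ^+ m by rewrite exprn_ge0// ltW.
have i0 : 0 <= (1 - c)^-1 by rewrite invr_ge0; lra.
have i2 : (1 - c)^-1 <= 2 by rewrite -[2]invrK lef_pV2 ?posrE; lra.
rewrite ger0_norm; last by apply: mulr_ge0; [exact: mulr_ge0|exact: ltW].
apply: (@le_trans _ _ (c ^+ m * 2 * 2^-1)); last first.
  by rewrite mulfK// lerXn2r// ?nnegrE ltW.
by rewrite ler_wpM2r ?(ltW h2)// ler_wpM2l.
Qed.

Lemma cvg_half_pow : (2^-1 ^+ m : R) @[m --> \oo] --> (0 : R).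
Proof.
have := @cvg_geometric R 1 2^-1; rewrite ger0_norm ?invr_ge0// => /(_ ltac:(lra)) h.
by apply: cvg_trans h; apply: near_eq_cvg; apply: nearW => m /=; rewrite mul1r.
Qed.

Lemma cvg_log_partial : log_partial m 2^-1 @[m --> \oo] --> (ln 2 : R).
Proof.
have h : (ln 2 - log_partial m 2^-1) @[m --> \oo] --> (0 : R).
  apply: norm_cvg0; apply: (@squeeze_cvgr _ _ _ _ (fun=> 0) (fun m => 2^-1 ^+ m)).
  - by apply: nearW => m; rewrite normr_ge0 ln2_log_partial.
  - exact: cvg_cst.
  - exact: cvg_half_pow.
have -> : (fun m => log_partial m 2^-1) = (fun m => ln 2 - (ln 2 - log_partial m 2^-1)).
  by apply/funext => m; rewrite opprB addrC subrK.
rewrite -[X in _ --> X]subr0; apply: cvgB => //; exact: cvg_cst.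
Qed.

(** Both parts of the sum of 2^-1 ^+ i * (i%:R^-1 - i.+1%:R^-1) are partial sums of the
    logarithmic series at 1/2, the second one shifted by one. *)
Lemma same_side_limitE m : same_side_limit R m.+1 =
  2 * log_partial m.+1 2^-1 - log_partial m 2^-1 - m.+1%:R^-1.
Proof.
elim: m => [|m IH].
  by rewrite /same_side_limit big_geq// /log_partial big_nat1 big_geq// expr1; field.
rewrite /same_side_limit big_nat_recr//= -/(same_side_limit R m.+1) IH.
have e k : log_partial k.+1 2^-1 = log_partial k 2^-1 + 2^-1 ^+ k.+1 / k.+1%:R.
  by rewrite /log_partial big_nat_recr.
rewrite [log_partial m.+2 _]e [log_partial m.+1 _]e [2^-1 ^+ m.+2]exprS.
have n1 : m.+1%:R != 0 :> R by [].
have n2 : m.+2%:R != 0 :> R by [].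
move: n1 n2; move: (m.+1%:R : R) (m.+2%:R : R) (2^-1 ^+ m.+1 : R) => u1 u2 p n1 n2.
by field; rewrite n1 n2.
Qed.

Lemma cvg_same_side_limit : same_side_limit R m @[m --> \oo] --> (ln 2 : R).
Proof.
rewrite -cvg_shiftS.
have -> : [sequence same_side_limit R m.+1]_m =
   (fun m => 2 * log_partial m.+1 2^-1 - log_partial m 2^-1 - harmonic m).
  by apply/funext => m; rewrite /= same_side_limitE.
have -> : (ln 2 : R) = 2 * ln 2 - ln 2 - 0 by lra.
apply: cvgB; last exact: cvg_harmonic.
apply: cvgB; last exact: cvg_log_partial.
apply: cvgM; first exact: cvg_cst.
by have := cvg_log_partial; rewrite -cvg_shiftS.
Qed.

Lemma cvg_limit_sibling_rate : limit_sibling_rate R m @[m --> \oo] --> ((1 + ln 2) / 2 : R).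
Proof.
rewrite /limit_sibling_rate; apply: cvgM; last exact: cvg_cst.
apply: cvgD; last exact: cvg_same_side_limit.
rewrite -cvg_shiftS.
have -> : [sequence (m.+1%:R - 2) / m.+1%:R : R]_m = (fun m => 1 - 2 * harmonic m).
  by apply/funext => m; rewrite /harmonic /= mulrBl mulfV.
have : (fun m => 1 - 2 * @harmonic R m) @ \oo --> (1 - 2 * 0 : R).
  apply: cvgB; first exact: cvg_cst.
  by apply: cvgM; [exact: cvg_cst|exact: cvg_harmonic].
by rewrite mulr0 subr0.
Qed.

Lemma cvg_sum_ratio (u : nat -> R) (l : R) : u m @[m --> \oo] --> l ->
  (\sum_(0 <= i < n) u i) / n%:R @[n --> \oo] --> l.
Proof.
move=> /cesaro h; rewrite -cvg_shiftS; apply: cvg_trans h; apply: near_eq_cvg.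
by apply: nearW => n; rewrite /arithmetic_mean /series /= mulrC.
Qed.

Lemma cvg_natpow p : (0 < p)%N -> (k ^ p)%N @[k --> \oo] --> \oo.
Proof.
move=> p0; apply/cvgnyPge => A; near=> k.
have Ak : (A <= k)%N by near: k; exact: nbhs_infty_ge.
apply: leq_trans Ak _; case: (k) => // k'; by rewrite -{1}(expn1 k'.+1) leq_pexp2l.
Unshelve. all: by end_near.
Qed.

Lemma cvg_rrt_mean : rrt_mean R n.-1 / n%:R @[n --> \oo] --> (1 : R).
Proof.
pose u (i : nat) : R := i.-1%:R / i%:R.
have hu : u m @[m --> \oo] --> (1 : R).
  rewrite -cvg_shiftS.
  have -> : [sequence u m.+1]_m = (fun m => 1 - @harmonic R m).
    apply/funext => m; have e : m%:R = m.+1%:R - 1 :> R by rewrite -natr1 addrK.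
    by rewrite /u /harmonic /= e mulrBl mulfV// mul1r.
  have : (fun m => 1 - @harmonic R m) @ \oo --> (1 - 0 : R).
    by apply: cvgB; [exact: cvg_cst|exact: cvg_harmonic].
  by rewrite subr0.
have := cvg_sum_ratio hu; apply: cvg_trans; apply: near_eq_cvg; apply: nearW => n.
congr (_ / _); case: n => [|n]; first by rewrite /rrt_mean !big_geq.
by rewrite /rrt_mean /= big_nat_recl// {1}/u mul0r add0r.
Qed.

End Limits.

Section MeanSiblings.
Variable R : realType.

(** Each pair of siblings is counted once for each of its members. *)
Lemma mean_siblings_pairs (a : nat -> nat) n :
  mean_siblings R a n = 2 * ((pairs (map a (iota 2 n.-1)))%:R / n%:R).
Proof.
rewrite /mean_siblings mulrCA mulrC mulrA; congr (_ / _).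
set s := map a _.
have sib i : siblings R a n i = (count_mem (a i) s)%:R - 1.
  rewrite /siblings; congr (_%:R - 1); rewrite cardsE /s count_map.
  rewrite -sum1_card -sum1_count big_mkcond [RHS]big_mkcond /=.
  rewrite -(big_mkord xpredT (fun j => if (2 <= j)%N && (a j == a i) then 1%N else 0%N)).
  case: n s => [|n] s /=; first by rewrite big_nat1 big_nil.
  rewrite big_ltn// big_ltn// !add0n /index_iota subSS subSS subn0.
  by rewrite [LHS]big_seq [RHS]big_seq; apply: eq_bigr => j; rewrite mem_iota => /andP[-> _].
under eq_bigr do rewrite sib.
rewrite /index_iota subSS subn1 sumrB -natr_sum -(big_map a xpredT (fun x => count_mem x s)) -/s.
rewrite sum_count_mem size_map size_iota natrD -mul2n natrM.
rewrite big_const_seq count_predT size_iota iter_addr addr0.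
by rewrite addrAC subrr add0r mulrC.
Qed.

Lemma le_pairs_tree (a : nat -> nat) :
  {homo (fun n => (pairs (map a (iota 2 n.-1)))%:R : R) : m n / (m <= n)%N >-> m <= n}.
Proof.
move=> m n mn; rewrite ler_nat (_ : n.-1 = m.-1 + (n.-1 - m.-1))%N; last by lia.
by rewrite iotaD map_cat pairs_cat.
Qed.

End MeanSiblings.

(** * Random recursive trees *)

Section Independence.
Context (d d' : measure_display) (Omega : measurableType d) (T : measurableType d')
  (R : realType) (P : probability Omega R).

Lemma prod_lee (I : eqType) (r : seq I) (f : I -> \bar R) (q : I -> R) :
  (forall i, 0 <= f i)%E -> {in r, forall i, (f i <= (q i)%:E)%E} ->
  (\prod_(i <- r) f i <= (\prod_(i <- r) q i)%:E)%E.
Proof.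
move=> f0; elim: r => [|i r IH] fq; first by rewrite !big_nil.
rewrite !big_cons EFinM; apply: lee_pmul => //.
- by elim/big_rec: _ => // j x _ x0; exact: mule_ge0.
- by apply: fq; rewrite mem_head.
- by apply: IH => j jr; apply: fq; rewrite inE jr orbT.
Qed.

Lemma independent_word_le (D : set nat) (Y : nat -> Omega -> T) a n (B : nat -> set T)
    (q : nat -> R) :
  independent_family P D Y -> (forall i, (i < n)%N -> D (a + i)%N) ->
  (forall i, measurable (B i)) ->
  (forall i, (i < n)%N -> (P (Y (a + i)%N @^-1` B i) <= (q i)%:E)%E) ->
  (P [set w | forall i, (i < n)%N -> B i (Y (a + i)%N w)] <= (\prod_(i < n) q i)%:E)%E.
Proof.
move=> ind Da mB PB.
pose s := [fset i in iota a n]%fset.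
have sE i : (i \in s) = (a <= i < a + n)%N by rewrite inE mem_iota.
have -> : [set w | forall i, (i < n)%N -> B i (Y (a + i)%N w)] =
    \bigcap_(i in [set` s]) (Y i @^-1` B (i - a)%N).
  apply/seteqP; split => w /= h.
    move=> i /=; rewrite sE => ia /=.
    by have := h (i - a)%N; rewrite subnKC; [apply|]; lia.
  move=> i ilt; have := h (a + i)%N; rewrite /= addKn; apply.
  by rewrite sE; lia.
rewrite (ind s (fun i => B (i - a)%N)) //; last first.
  move=> i /=; rewrite sE => ia; have := Da (i - a)%N; rewrite subnKC; [apply|]; lia.
have -> : (\prod_(i <- s) P (Y i @^-1` B (i - a)%N))%E =
    (\prod_(i <- iota a n) P (Y i @^-1` B (i - a)%N))%E.
  apply: perm_big; apply: uniq_perm; [exact: fset_uniq|exact: iota_uniq|].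
  by move=> i; rewrite sE mem_iota.
have -> : \prod_(i < n) q i = \prod_(i <- iota a n) q (i - a)%N.
  have -> : iota a n = map (addn a) (iota 0 n) by rewrite -iotaDl addn0.
  rewrite -(big_mkord xpredT q) /index_iota subn0 big_map.
  by apply: eq_bigr => i _; rewrite addKn.
apply: prod_lee => [i|i]; first exact: measure_ge0.
rewrite mem_iota => ia; have := PB (i - a)%N; rewrite subnKC; [apply|]; lia.
Qed.

Lemma measurable_word_event (Y : nat -> Omega -> T) a n (B : nat -> set T) :
  (forall i, measurable_fun setT (Y i)) -> (forall i, measurable (B i)) ->
  measurable [set w | forall i, (i < n)%N -> B i (Y (a + i)%N w)].
Proof.
move=> mY mB.
have -> : [set w | forall i, (i < n)%N -> B i (Y (a + i)%N w)] =
    \bigcap_(i in [set i | (i < n)%N]) (Y (a + i)%N @^-1` B i).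
  by apply/seteqP; split.
apply: bigcap_measurableType => i _.
by rewrite -[_ @^-1` _]setTI; apply: mY.
Qed.

End Independence.

Section RandomRecursiveTreeLaw.
Context (d : measure_display) (Omega : measurableType d) (R : realType).
Variables (P : probability Omega R) (A : nat -> {RV P >-> nat}).
Hypothesis UA : uniform_attachment A.

Let S (i : nat) := iota 1 i.+1.

Lemma parents_out_of_range_negligible :
  exists Z : set Omega, [/\ measurable Z, P Z = 0 &
    forall w, ~ Z w -> forall n, (2 <= n)%N -> (1 <= A n w < n)%N].
Proof.
pose F (n i : nat) : set Omega :=
  if (2 <= n)%N && ~~ (1 <= i < n)%N then A n @^-1` [set i] else set0.
have nF n i : P.-negligible (F n i).
  rewrite /F; case: ifP => [/andP[n2 ni]|_]; last exact: negligible_set0.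
  apply/negligibleP; first by rewrite -[_ @^-1` _]setTI; apply: measurable_funPT.
  have [/(_ n i n2) h _] := UA.
  by move: h; rewrite (negbTE ni).
(* Countably many null events: one for each vertex and each value out of range. *)
have [Z [mZ Z0 FZ]] : P.-negligible (\bigcup_n \bigcup_i F n i).
  by apply: negligible_bigcup => n; apply: negligible_bigcup.
exists Z; split => // w nZ n n2; apply: contrapT => /negP h; apply: nZ; apply: FZ.
by exists n => //; exists (A n w) => //; rewrite /F n2 h.
Qed.

Lemma rrt_word_le n s : s \in words S n ->
  (P [set w | forall i, (i < n)%N -> A (2 + i)%N w = nth 0%N s i]
    <= ((size (words S n))%:R^-1)%:E)%E.
Proof.
move=> /(wordsP S 0%N)[_ sS]; have [law ind] := UA.
apply: le_trans (independent_word_le (a := 2) (n := n) (B := fun i => [set nth 0%N s i])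
  (q := fun i => i.+1%:R^-1) ind _ _ _) _ => //.
  move=> i ilt; have := law (2 + i)%N (nth 0%N s i) isT; rewrite /distribution /pushforward => ->.
  by have := sS i ilt; rewrite mem_iota => h; rewrite ifT//; lia.
rewrite lee_fin size_words natr_prod prodfV.
by under [in leRHS]eq_bigr do rewrite size_iota.
Qed.

(** Outside a null event the parents form a word, to which rrt_variance applies by
    Chebyshev's inequality. *)
Lemma rrt_deviation e n : 0 < e -> (0 < n)%N -> exists E : set Omega,
  [/\ measurable E, (P E <= (3 / (e ^+ 2 * n%:R))%:E)%E &
    forall w, e * n%:R <= `|(pairs (map (A ^~ w) (iota 2 n.-1)))%:R - rrt_mean R n.-1| -> E w].
Proof.
move=> e0 n0; have [Z [mZ Z0 hZ]] := parents_out_of_range_negligible.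
have n0' : 0 < n%:R :> R by rewrite ltr0n.
pose b (s : seq nat) := e * n%:R <= `|(pairs s)%:R - rrt_mean R n.-1|.
pose C (s : seq nat) := [set w | forall i, (i < n.-1)%N -> A (2 + i)%N w = nth 0%N s i].
have [||E [mE PE CE]] := @words_event_le _ Omega R P _ S n.-1 C b.
- move=> s _.
  by apply: (@measurable_word_event _ _ Omega _ (fun i => A i) 2 n.-1 (fun i => [set nth 0%N s i])).
- by move=> s; exact: rrt_word_le.
exists (E `|` Z); split; first exact: measurableU.
  apply: le_trans (measureU2 P mE mZ) _.
  rewrite [X in (_ + X)%E](_ : _ = 0%E) ?adde0//; apply: le_trans PE _; rewrite lee_fin.
  apply: le_trans (mean_chebyshev _ _ _ _) _; first by rewrite mulr_gt0.
  apply: (@le_trans _ _ (3 * n.-1%:R / (e * n%:R) ^+ 2)).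
    by rewrite ler_wpM2r ?rrt_variance// invr_ge0 sqr_ge0.
  apply: (@le_trans _ _ (3 * n%:R / (e * n%:R) ^+ 2)).
    by rewrite ler_wpM2r ?invr_ge0 ?sqr_ge0// ler_wpM2l// ler_nat leq_pred.
  by rewrite le_eqVlt; apply/orP; left; apply/eqP; field; rewrite !gt_eqF.
move=> w dw; have [Zw|nZ] := pselect (Z w); [by right|left].
have nthA i : (i < n.-1)%N -> nth 0%N (map (A ^~ w) (iota 2 n.-1)) i = A (2 + i)%N w.
  by move=> ilt; rewrite (nth_map 0%N) ?size_iota// nth_iota.
apply: (CE (map (A ^~ w) (iota 2 n.-1))) => //.
  apply/(wordsP S 0%N); split; first by rewrite size_map size_iota.
  by move=> i ilt; rewrite nthA// mem_iota; have := hZ w nZ (2 + i)%N isT; lia.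
by move=> i ilt; rewrite nthA.
Qed.

Theorem rrt_mean_siblings :
  {ae P, forall w, mean_siblings R (fun k => A k w) n @[n --> \oo] --> (2 : R)}.
Proof.
have h : {ae P, forall w,
    (fun n w => (pairs (map (A ^~ w) (iota 2 n.-1)))%:R) n w / n%:R @[n --> \oo] --> (1 : R)}.
  apply: (@ae_cvg_of_summable_deviations _ _ _ _ _ (fun k => rrt_mean R (k ^ 6).-1) 6) => //.
  - by move=> w; exact: le_pairs_tree.
  - by have := cvg_comp _ _ (@cvg_natpow 6 isT) (@cvg_rrt_mean R).
  move=> e e0; exists (3 / e ^+ 2) => k k0.
  have k60 : (0 < k ^ 6)%N by rewrite expn_gt0 k0.
  have [E [mE PE hE]] := rrt_deviation e0 k60; exists E; split => //.
  apply: le_trans PE _; rewrite lee_fin invfM mulrA ler_wpM2l//.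
    by rewrite divr_ge0// sqr_ge0.
  rewrite -natrX lef_pV2 ?posrE ?ltr0n ?expn_gt0 ?k0// ler_nat leq_pexp2l//.
apply: filterS h => w h.
rewrite (_ : (fun n => mean_siblings R _ n) =
    (fun n => 2 * ((pairs (map (A ^~ w) (iota 2 n.-1)))%:R / n%:R))); last first.
  by apply/funext => n; exact: mean_siblings_pairs.
have : (fun n => 2 * ((pairs (map (A ^~ w) (iota 2 n.-1)))%:R / n%:R)) @ \oo --> (2 * 1 : R).
  by apply: cvgM => //; exact: cvg_cst.
by rewrite mulr1.
Qed.

End RandomRecursiveTreeLaw.

(** * Nearest-neighbour trees on the circle *)

Lemma pairs_map_inj (T U : eqType) (f : T -> U) s : injective f -> pairs (map f s) = pairs s.
Proof.
move=> fi; elim: s => //= x s ->; congr addn; rewrite count_map; apply: eq_count => y /=.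
by rewrite (inj_eq fi).
Qed.

Lemma max_degree_pow k : (0 < k)%N -> (max_degree (k ^ 30).*2 <= 62 * k)%N.
Proof.
move=> k0; have k30 : (0 < k ^ 30)%N by rewrite expn_gt0 k0.
rewrite /max_degree -(@leq_pmul2l 2) // mulnA.
have : (trunc_log 2 (k ^ 30).*2 <= k * 30)%N.
  rewrite -ltnS -(@ltn_exp2l 2)//; apply: leq_ltn_trans (trunc_logP _ _) _ => //.
    by rewrite double_gt0.
  by rewrite (expnS 2) -mul2n ltn_pmul2l// expnM ltn_exp2r// ltn_expl.
by lia.
Qed.

Section NearestNeighbourTreeLaw.
Context (d : measure_display) (Omega : measurableType d) (R : realType).
Variables (P : probability Omega R) (X : nat -> {RV P >-> (R * R)%type}).
Variables (A : nat -> {RV P >-> nat}).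
Hypothesis iidX : iid_on_circle X.
Hypothesis nnA : forall n w, (2 <= n)%N -> A n w \in nearest (fun i => X i w) n.

Lemma circle_word_le M n (s : seq 'I_(M.*2).+1) : (0 < M)%N ->
  s \in words (fun=> enum 'I_(M.*2).+1) n ->
  (P [set w | forall i, (i < n)%N -> circle_arc (nth 0%R s i) (X (1 + i)%N w)]
    <= ((size (words (fun=> enum 'I_(M.*2).+1) n))%:R^-1)%:E)%E.
Proof.
move=> M0 _; have [_ law ind] := iidX.
apply: le_trans (@independent_word_le _ _ Omega _ R P _ (fun i => X i) 1 n (fun i => circle_arc
  (nth 0 s i))
  (fun=> (M.*2).+1%:R^-1) ind _ _ _) _ => //.
- by move=> i; exact: measurable_circle_arc.
- move=> i ilt; have := law (1 + i)%N isT _ (measurable_circle_arc (nth 0 s i)).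
  by rewrite /distribution /pushforward => ->; exact: circle_law_circle_arc.
rewrite lee_fin size_words natr_prod prodfV.
by under [in leRHS]eq_bigr do rewrite size_enum_ord.
Qed.

(** The labels of vertices start from 1 and those of letters from 0. *)
Lemma tree_pairs M n (s : seq 'I_(M.*2).+1) w : (0 < M)%N ->
  (forall i, (i < n)%N -> circle_arc (nth 0 s i) (X (1 + i)%N w)) ->
  ~~ has_near_tie (nth 0 s) n ->
  pairs (map (A ^~ w) (iota 2 n.-1)) = sibling_pairs predT (nth 0 s) n.
Proof.
move=> M0 arcs sep; have [onC _ _] := iidX.
pose parent k := (A k.+1 w).-1.
have A_near k : (0 < k)%N -> A k.+1 w = (parent k).+1 /\ (parent k < k)%N /\
    forall j, (j < k)%N -> euclid_dist (X (parent k).+1 w) (X k.+1 w) <= euclid_dist (X j.+1 w) (X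
      k.+1 w).
  move=> k0; have k1 : (2 <= k.+1)%N by [].
  have := nnA w k1; rewrite /nearest mem_filter mem_index_iota => /andP[/allP h Ak].
  have AE : A k.+1 w = (parent k).+1 by rewrite /parent prednK//; case/andP: Ak.
  split=> //; split; first by rewrite -AE in Ak *; move: Ak; rewrite AE; lia.
  by move=> j jk; rewrite -AE; apply: h; rewrite mem_index_iota.
have pk k : (0 < k < n)%N -> (parent k < k)%N by case/andP => /A_near[_ []].
have -> : map (A ^~ w) (iota 2 n.-1) = map succn (map parent (iota 1 n.-1)).
  rewrite (_ : 2 = 1 + 1)%N// iotaDl -!map_comp; apply/eq_in_map => k;
    rewrite mem_iota => /andP[k0 _] /=.
  by rewrite add1n; case: (A_near k k0).
rewrite pairs_map_inj; last exact: succn_inj.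
apply: pairs_sibling_pairs => //.
apply: (@child_nearest _ _ (fun i j k => euclid_dist (X i.+1 w) (X k.+1 w) <= euclid_dist (X j.+1
  w) (X k.+1 w))) => //.
  move=> i j k iN jN kN far; rewrite -ltNge.
  by apply: (circle_arc_closer M0 _ _ _ (arcs i iN) (arcs j jN) (arcs k kN) far); exact: onC.
by move=> k /andP[k0 _]; case: (A_near k k0).
Qed.

(** The first term bounds the probability of near ties, the second one comes from
    Chebyshev's inequality and sibling_pairs_variance. *)
Lemma circle_deviation e n M : 0 < e -> (0 < n)%N -> (0 < M)%N ->
  let mu := mean (words (fun=> enum 'I_(M.*2).+1) n)
      (fun s => (sibling_pairs predT (nth 0 s) n)%:R : R) in
  exists E : set Omega, [/\ measurable E,
    (P E <= (6 * n%:R ^+ 3 / (M.*2).+1%:R +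
       (4 * (max_degree M).+1 ^ 2)%:R ^+ 2 / (e ^+ 2 * n%:R))%:E)%E &
    forall w, e * n%:R <= `|(pairs (map (A ^~ w) (iota 2 n.-1)))%:R - mu| -> E w].
Proof.
move=> e0 n0 M0 mu; pose W := words (fun=> enum 'I_(M.*2).+1) n.
have n0' : 0 < n%:R :> R by rewrite ltr0n.
pose b1 (s : seq 'I_(M.*2).+1) := has_near_tie (nth 0 s) n.
pose b2 (s : seq 'I_(M.*2).+1) := e * n%:R <= `|(sibling_pairs predT (nth 0 s) n)%:R - mu|.
pose b s := b1 s || b2 s.
pose C (s : seq 'I_(M.*2).+1) := [set w | forall i, (i < n)%N -> circle_arc (nth 0 s i) (X (1 +
  i)%N w)].
have [||E [mE PE CE]] := @words_event_le _ Omega R P _ (fun=> enum 'I_(M.*2).+1) n C b.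
- move=> s _; apply: (@measurable_word_event _ _ Omega _ (fun i => X i) 1 n (fun i => circle_arc
  (nth 0 s i))) => //.
  by move=> i; exact: measurable_circle_arc.
- by move=> s; exact: circle_word_le.
exists E; split => //.
  apply: le_trans PE _; rewrite lee_fin.
  apply: (@le_trans _ _ (mean W (fun s => (b1 s)%:R + (b2 s)%:R))).
    by apply: ler_mean => s; rewrite /b; case: (b1 s); case: (b2 s);
      rewrite /= ?addr0 ?add0r// lerDl.
  rewrite meanD; apply: lerD; first exact: mean_near_tie.
  apply: le_trans (mean_chebyshev _ _ _ _) _; first by rewrite mulr_gt0.
  apply: (@le_trans _ _ (n%:R * (4 * (max_degree M).+1 ^ 2)%:R ^+ 2 / (e * n%:R) ^+ 2)).
    by rewrite ler_wpM2r ?invr_ge0 ?sqr_ge0//; exact: sibling_pairs_variance.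
  by rewrite le_eqVlt; apply/orP; left; apply/eqP; field; rewrite !gt_eqF.
move=> w dw; have [onC _ _] := iidX.
have /choice[c hc] : forall i, exists c : 'I_(M.*2).+1, circle_arc c (X (1 + i)%N w).
  by move=> i; apply: circle_arc_cover => //; exact: onC.
pose s := map c (iota 0 n).
have ns i : (i < n)%N -> nth 0 s i = c i.
  by move=> ilt; rewrite (nth_map 0%N) ?size_iota// nth_iota.
apply: (CE s).
- apply/(wordsP _ 0); split; first by rewrite size_map size_iota.
  by move=> i _; rewrite mem_enum.
- rewrite /b; case: (boolP (b1 s)) => //= nb1; rewrite /b2.
  rewrite -(@tree_pairs M n s w) // => i ilt; rewrite ns//.
- by move=> i ilt; rewrite ns.
Qed.

Theorem nnt_mean_siblings :
  {ae P, forall w, mean_siblings R (fun k => A k w) n @[n --> \oo] --> (1 + ln 2 : R)}.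
Proof.
(* A power of k large enough for the probability of near ties, of order
   (k ^ 6) ^ 3 / H k, to be summable, while max_degree remains O(k). *)
pose H k := (k ^ 30)%N.
pose mu k := mean (words (fun=> enum 'I_((H k).*2.*2).+1) (k ^ 6)%N)
      (fun s => (sibling_pairs predT (nth 0 s) (k ^ 6)%N)%:R : R).
have muL : mu k / (k ^ 6)%:R @[k --> \oo] --> ((1 + ln 2) / 2 : R).
  have tail (u : nat -> R) (l : R) : u m @[m --> \oo] --> l ->
      (\sum_(2 <= m < (k ^ 6)%N) u m) / (k ^ 6)%:R @[k --> \oo] --> l.
    move=> ul; pose v m := if (2 <= m)%N then u m else 0.
    have vl : v m @[m --> \oo] --> l.
      apply: cvg_trans ul; apply: near_eq_cvg; near=> m; rewrite /v ifT//.
      by near: m; exact: nbhs_infty_ge.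
    apply: cvg_trans (cvg_comp _ _ (@cvg_natpow 6 isT) (cvg_sum_ratio vl)).
    apply: near_eq_cvg; near=> k => /=; congr (_ / _).
    have k2 : (2 <= k)%N by near: k; exact: nbhs_infty_ge.
    rewrite (@big_cat_nat _ _ _ 2)//=; last first.
      apply: leq_trans (k2) _; have /(@leq_pexp2l k 1 6) : (0 < k)%N by exact: (ltnW k2).
      by rewrite expn1; exact.
    rewrite big_nat [X in X + _]big1 ?add0r => [|m /andP[_ m2]]; last by rewrite /v leqNgt m2.
    by apply: eq_big_nat => m /andP[m2 _]; rewrite /v m2.
  have rate := tail _ _ (@cvg_limit_sibling_rate R).
  have inv : (\sum_(2 <= m < (k ^ 6)%N) (m.-1%:R^-1 : R)) / (k ^ 6)%:R @[k --> \oo] --> (0 : R).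
    apply: tail; rewrite -(@cvg_shiftS _ (fun m => m.-1%:R^-1 : R)) -cvg_shiftS.
    exact: cvg_harmonic.
  have inv_k : (k%:R^-1 : R) @[k --> \oo] --> (0 : R).
    by rewrite -cvg_shiftS; exact: cvg_harmonic.
  have diff : (mu k / (k ^ 6)%:R - (\sum_(2 <= m < (k ^ 6)%N) limit_sibling_rate R m) / (k ^ 6)%:R)
      @[k --> \oo] --> (0 : R).
    apply: norm_cvg0; apply: (@squeeze_cvgr _ _ _ _ (fun=> 0)
      (fun k => 69 * k%:R^-1 + (\sum_(2 <= m < (k ^ 6)%N) (m.-1%:R^-1 : R)) / (k ^ 6)%:R)).
    - near=> k; rewrite normr_ge0 /= -mulrBl.
      have k0 : (0 < k)%N by near: k; exact: nbhs_infty_gt.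
      have Hk0 : (0 < H k)%N by rewrite expn_gt0 k0.
      have kp : 0 < (k ^ 6)%:R :> R by rewrite ltr0n expn_gt0 k0.
      rewrite normrM normfV (gtr0_norm kp).
      have kr : 0 < k%:R :> R by rewrite ltr0n.
      apply: le_trans (ler_wpM2r _ (mean_sibling_pairs_close R Hk0 (k ^ 6))) _.
        by rewrite invr_ge0 ltW.
      rewrite mulrDl lerD2r mulrDl (_ : 69 = 62 + 7 :> R); last by rewrite -natrD.
      rewrite [leRHS]mulrDl; apply: lerD.
        rewrite ler_pdivrMr// (_ : 62 / k%:R * _ = 62 * k%:R ^+ 5); last first.
          by rewrite natrX; field; rewrite gt_eqF.
        rewrite -natrX -natrM ler_nat; apply: leq_trans (max_degree_pow k0) _.
        by rewrite leq_mul2l /= -{1}(expn1 k) leq_pexp2l.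
      have Mp : 0 < (H k).*2%:R :> R by rewrite ltr0n double_gt0.
      rewrite ler_pdivrMr// ler_pdivrMr//.
      rewrite (_ : 7 / k%:R * _ * _ = 7 * (2 * k%:R ^+ 35)); last first.
        rewrite /H -mul2n natrM !natrX (exprD _ 5 30) (exprS _ 5).
        by move: (k%:R ^+ 5) (k%:R ^+ 30) => x y; field; rewrite gt_eqF.
      rewrite ler_wpM2l// -!natrX -natrM ler_nat -expnM.
      apply: (@leq_trans (k ^ 35)); first by rewrite leq_pexp2l.
      by move: (k ^ 35)%N => x; lia.
    - exact: cvg_cst.
    - have : (fun k => 69 * k%:R^-1 + (\sum_(2 <= m < (k ^ 6)%N) (m.-1%:R^-1 : R)) / (k ^ 6)%:R)
        @ \oo --> (69 * 0 + 0 : R).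
        by apply: cvgD => //; apply: cvgM => //; exact: cvg_cst.
      by rewrite mulr0 addr0.
  pose L k := (\sum_(2 <= m < (k ^ 6)%N) limit_sibling_rate R m) / (k ^ 6)%:R.
  have -> : (fun k => mu k / (k ^ 6)%:R) = (fun k => (mu k / (k ^ 6)%:R - L k) + L k).
    by apply/funext => k; rewrite subrK.
  have sum_lim : (fun k => (mu k / (k ^ 6)%:R - L k) + L k) @ \oo --> (0 + (1 + ln 2) / 2 : R).
    exact: cvgD diff rate.
  by rewrite add0r in sum_lim.
have h : {ae P, forall w,
    (fun n w => (pairs (map (A ^~ w) (iota 2 n.-1)))%:R) n w / n%:R @[n --> \oo] --> ((1 + ln 2) /
      2 : R)}.
  apply: (@ae_cvg_of_summable_deviations _ _ _ _ _ mu 6) => //.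
    by move=> w; exact: le_pairs_tree.
  move=> e e0; exists (6 + (4 * 63 ^ 2) ^+ 2 / e ^+ 2) => k k0.
  have k60 : (0 < k ^ 6)%N by rewrite expn_gt0 k0.
  have H0 : (0 < (H k).*2)%N by rewrite double_gt0 expn_gt0 k0.
  have [E [mE PE hE]] := circle_deviation e0 k60 H0; exists E; split => //.
  have kr : 0 < k%:R :> R by rewrite ltr0n.
  apply: le_trans PE _; rewrite lee_fin [leRHS]mulrDl; apply: lerD.
    rewrite ler_pdivrMr// mulrAC ler_pdivlMr ?exprn_gt0// -mulrA ler_wpM2l//.
    rewrite -!natrX -natrM ler_nat -expnM -expnD /H.
    apply: (@leq_trans (k ^ 30)); first by rewrite leq_pexp2l.
    by move: (k ^ 30)%N => x; lia.
  apply: (@le_trans _ _ ((4 * (63 * k%:R) ^+ 2) ^+ 2 / (e ^+ 2 * (k ^ 6)%:R))).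
    apply: ler_wpM2r; first by rewrite invr_ge0 mulr_ge0 ?sqr_ge0.
    rewrite lerXn2r ?nnegrE ?mulr_ge0 ?sqr_ge0// natrM ler_wpM2l// natrX.
    rewrite lerXn2r ?nnegrE ?mulr_ge0// -natrM ler_nat.
    by have := max_degree_pow k0; rewrite -/(H k); lia.
  by rewrite natrX le_eqVlt; apply/orP; left; apply/eqP; field; rewrite !gt_eqF.
apply: filterS h => w h.
rewrite (_ : (fun n => mean_siblings R _ n) =
    (fun n => 2 * ((pairs (map (A ^~ w) (iota 2 n.-1)))%:R / n%:R))); last first.
  by apply/funext => n; exact: mean_siblings_pairs.
have : (fun n => 2 * ((pairs (map (A ^~ w) (iota 2 n.-1)))%:R / n%:R)) @ \oo --> (2 * ((1 + ln 2)
  / 2) : R).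
  by apply: cvgM => //; exact: cvg_cst.
by rewrite mulrC divfK.
Unshelve. all: by end_near.
Qed.

End NearestNeighbourTreeLaw.

Theorem theorem1 (R : realType) :
  (forall (d : measure_display) (Omega : measurableType d)
          (P : probability Omega R)
          (X : nat -> {RV P >-> (R * R)%type}) (A : nat -> {RV P >-> nat}),
     iid_on_circle X -> nearest_neighbour_attachment X A ->
     {ae P, forall w,
        mean_siblings R (fun k => A k w) n @[n --> \oo] --> (1 + ln 2 : R)})
  /\
  (forall (d : measure_display) (Omega : measurableType d)
          (P : probability Omega R) (A : nat -> {RV P >-> nat}),
     uniform_attachment A ->
     {ae P, forall w,
        mean_siblings R (fun k => A k w) n @[n --> \oo] --> (2 : R)}).
Proof.
split=> [d Omega P X A iidX [nnA _]|d Omega P A UA].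
  exact: nnt_mean_siblings iidX nnA.
exact: rrt_mean_siblings UA.
Qed.
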